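(* Assume (A1)–(A5) from the context. Let $T\ge1$, and let the step sizes $\alpha,\beta>0$ satisfy $$0<\alpha(\rho+L)+4\alpha^2L^2\le\min\left\{\tfrac12,\ \frac{4\mu(\rho+L)+64L^2}{\mu^2}\right\}$$ and $$12(6+\delta)\beta^2K^2L^2\le\min\left\{\tfrac1{16},\ 1-\tfrac{\alpha\mu}{4}\right\},\qquad\text{where }\delta=\frac1{(1-\alpha\rho)^2}.$$ Then the iterates generated by FedCanon satisfy $$\mathbb{E}[\phi(z^T)-\phi^*]+\alpha\mathcal{E}^T\le\left(1-\frac{\alpha\mu}{4}\right)^T\left[\phi(z^0)-\phi^*+\alpha\mathcal{E}^0\right]+\frac{25\sigma^2}{\mu BK}+\frac{\sigma^2}{16\mu B}+\frac{B_h}{2\mu}.$$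
   Context: Let $N,d,K,B$ be positive integers and $[N]=\{1,\dots,N\}$. For each client $i\in[N]$ let $f_i(x)=\mathbb{E}_{\xi\sim\mathcal{D}_i}[F_i(x;\xi)]$. Let $f=\frac1N\sum_{i=1}^N f_i$, let $h:\mathbb{R}^d\to\mathbb{R}\cup\{+\infty\}$, and let $\phi=f+h$. Standing assumptions: (A1) $\phi^*:=\inf_z\phi(z)>-\infty$. (A2) There is $L>0$ such that for every $i$ and all $x,y$: $f_i(x)-f_i(y)-\langle\nabla f_i(y),x-y\rangle\le \frac L2\Vert x-y\Vert^2$ and $\Vert\nabla f_i(x)-\nabla f_i(y)\Vert\le L\Vert x-y\Vert$. (A3) $h$ is proper, closed and $\rho$-weakly convex for some $\rho\ge0$, i.e. $h(z)+\frac{\rho}{2}\Vert z\Vert^2$ is convex. There is a constant $B_h$ such that $\Vert h'(z)\Vert^2\le B_h$ for every $z$ and every subgradient $h'(z)\in\partial h(z)$. (A4) Whenever client $i$ evaluates $g_i(x)$, it draws $B$ fresh samples $\xi_{i,1},\dots,\xi_{i,B}\sim\mathcal{D}_i$, independent of the past, and sets $g_i(x)=\frac1B\sum_{b}\nabla F_i(x;\xi_{i,b})$. Conditionally on the past, $\mathbb{E}[g_i(x)]=\nabla f_i(x)$ and $\mathbb{E}\Vert g_i(x)-\nabla f_i(x)\Vert^2\le\sigma^2/B$. (A5) (Generalized PL condition) There is $\mu>0$ such that for all $z\in\mathbb{R}^d$, $\Vert G^\alpha(z)\Vert^2\ge2\mu[\phi(z)-\phi^*]$. Proximal operator: $\mathbf{prox}_{\alpha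 h}\{y\}=\arg\min_x\{h(x)+\frac1{2\alpha}\Vert x-y\Vert^2\}$. Algorithm FedCanon. The inputs are $\alpha,\beta>0$, an initial point $z^0$, and control variables $c_i^0$ with $\sum_ic_i^0=\mathbf{0}_d$. For $t=0,1,\dots$: - every client $i$ sets $\hat x_i^{t,0}=z^t$; - for $k=0,\dots,K-1$ it updates $\hat x_i^{t,k+1}=\hat x_i^{t,k}-\beta[g_i(\hat x_i^{t,k})+c_i^t]$; - it forms $\Delta_i^{t+1}=\frac1{\beta K}(z^t-\hat x_i^{t,K})$; - the server computes $\bar\Delta^{t+1}=\frac1N\sum_i\Delta_i^{t+1}$ and $z^{t+1}=\mathbf{prox}_{\alpha h}\{z^t-\alpha\bar\Delta^{t+1}\}$; - every client updates $c_i^{t+1}=c_i^t+\bar\Delta^{t+1}-\Delta_i^{t+1}$. (The variant FedCanon II, with local prox steps from a common initialization, generates the same sequence.) Notation: - $G^\alpha(z,u)=\frac1\alpha(z-\mathbf{prox}_{\alpha h}\{z-\alpha u\})$ and $G^\alpha(z)=G^\alpha(z,\nabla f(z))$. - $v_i^t=\frac1K\sum_{k=0}^{K-1}g_i(\hat x_i^{t,k})$ and $\bar v^t=\frac1N\sum_iv_i^t$. - $\mathcal{E}^t=\frac1N\sum_i\mathbb{E}\Vert\nabla f_i(z^t)+c_i^t-\nabla f(z^t)\Vert^2$. For $t\ge1$ this equals $\frac1N\sum_i\mathbb{E}\Vert\nabla f_i(\hat x_i^{t,0})-v_i^{t-1}-\nabla f(z^t)+\bar v^{t-1}\Vert^2$.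 - $\mathbb{E}$ is expectation over all sampling. *)

(* Defs.v *)
From HB Require Import structures.
From mathcomp Require Import all_boot all_order all_algebra.
From mathcomp Require Import all_classical all_reals all_analysis.
Set Implicit Arguments. Unset Strict Implicit. Unset Printing Implicit Defensive.
Import Order.TTheory GRing.Theory Num.Theory.
Import numFieldNormedType.Exports.
Local Open Scope classical_set_scope.
Local Open Scope ring_scope.

Section Eucl.
Variables (R : realType) (d : nat).
Definition dotv (u v : 'rV[R]_d) : R := \sum_(j < d) u 0 j * v 0 j.
Definition normsq (u : 'rV[R]_d) : R := \sum_(j < d) (u 0 j) ^+ 2.
Definition enorm (u : 'rV[R]_d) : R := Num.sqrt (normsq u).
End Eucl.

Definition has_gradient (R : realType) (d : nat) (f : 'rV[R]_d -> R)
  (x g : 'rV[R]_d) : Prop :=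
  differentiable f x /\ forall u : 'rV[R]_d, 'd f x u = dotv g u.

Section Ext.
Variables (R : realType) (d : nat).
Local Open Scope ereal_scope.

Definition proper_fun (h : 'rV[R]_d -> \bar R) : Prop :=
  (exists z, h z < +oo) /\ (forall z, -oo < h z).

Definition lsc (h : 'rV[R]_d -> \bar R) : Prop :=
  forall (z : 'rV[R]_d) (a : R), a%:E < h z -> \forall y \near z, a%:E < h y.

Definition convex_ext (H : 'rV[R]_d -> \bar R) : Prop :=
  forall (x y : 'rV[R]_d) (l : R), (0 <= l <= 1)%R ->
    H (l *: x + (1 - l) *: y)%R <= l%:E * H x + (1 - l)%:E * H y.

Definition weakly_convex (rho : R) (h : 'rV[R]_d -> \bar R) : Prop :=
  convex_ext (fun z => h z + (rho / 2 * normsq z)%:E).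

Definition subgrad (h : 'rV[R]_d -> \bar R) (z v : 'rV[R]_d) : Prop :=
  h z \is a fin_num /\
  forall eps : R, (0 < eps)%R ->
    \forall y \near z,
      h z + (dotv v (y - z) - eps * enorm (y - z))%:E <= h y.

Definition is_prox (a : R) (h : 'rV[R]_d -> \bar R) (y p : 'rV[R]_d) : Prop :=
  forall x, h p + (normsq (p - y) / (2 * a))%:E
            <= h x + (normsq (x - y) / (2 * a))%:E.

Definition prox (a : R) (h : 'rV[R]_d -> \bar R) (y : 'rV[R]_d) : 'rV[R]_d :=
  xget y [set p | is_prox a h y p].

Definition phistar (phi : 'rV[R]_d -> \bar R) : \bar R := ereal_inf (range phi).
End Ext.

Definition favg (R : realType) (d N : nat) (f : 'I_N -> 'rV[R]_d -> R) (x : 'rV[R]_d) : R :=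
  N%:R^-1 * \sum_(i < N) f i x.
Definition gavg (R : realType) (d N : nat) (g : 'I_N -> 'rV[R]_d -> 'rV[R]_d)
  (x : 'rV[R]_d) : 'rV[R]_d :=
  N%:R^-1 *: \sum_(i < N) g i x.

Definition phi (R : realType) (d N : nat) (f : 'I_N -> 'rV[R]_d -> R)
  (h : 'rV[R]_d -> \bar R) (z : 'rV[R]_d) : \bar R :=
  ((favg f z)%:E + h z)%E.

Definition Gmap (R : realType) (d N : nat) (alpha : R) (h : 'rV[R]_d -> \bar R)
  (gf : 'I_N -> 'rV[R]_d -> 'rV[R]_d) (z : 'rV[R]_d) : 'rV[R]_d :=
  alpha^-1 *: (z - prox alpha h (z - alpha *: gavg gf z)).

Definition mutually_independent (R : realType) (I : eqType)
  (d1 : measure_display) (Omega : measurableType d1) (P : probability Omega R)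
  (d0 : measure_display) (X : measurableType d0) (Y : I -> Omega -> X) : Prop :=
  forall s : seq I, uniq s ->
  forall A : I -> set X, (forall i, measurable (A i)) ->
    P (\bigcap_(i in [set` s]) (Y i @^-1` A i)) = (\prod_(i <- s) P (Y i @^-1` A i))%E.

(* measurability of an R^d-valued map (Borel = coordinatewise) *)
Definition vmeasurable (R : realType) (d : nat)
  (d1 : measure_display) (Omega : measurableType d1) (Y : Omega -> 'rV[R]_d) : Prop :=
  forall j : 'I_d, measurable_fun setT (fun w => Y w 0 j).

Section FedCanon.
Variables (R : realType) (d N K B : nat).
Variables (d1 : measure_display) (Omega : measurableType d1).
Variables (d0 : measure_display) (X : measurableType d0).
Variables (alpha beta : R) (h : 'rV[R]_d -> \bar R).
(* gF i x xi = grad F_i(x; xi) *)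
Variable gF : 'I_N -> 'rV[R]_d -> X -> 'rV[R]_d.
(* xi t i k b w = sample xi_{i,b} drawn by client i at round t, local step k *)
Variable xi : nat -> 'I_N -> nat -> 'I_B -> Omega -> X.
Variables (z0 : 'rV[R]_d) (c0 : 'I_N -> 'rV[R]_d).

Definition gbatch (i : 'I_N) (x : 'rV[R]_d) (s : 'I_B -> X) : 'rV[R]_d :=
  B%:R^-1 *: \sum_(b < B) gF i x (s b).

Fixpoint xloc (t : nat) (i : 'I_N) (z ci : 'rV[R]_d) (w : Omega) (k : nat)
  : 'rV[R]_d :=
  match k with
  | 0 => z
  | k'.+1 => let x := xloc t i z ci w k' in
             x - beta *: (gbatch i x (fun b => xi t i k' b w) + ci)
  end.

Definition Delta (t : nat) (i : 'I_N) (z ci : 'rV[R]_d) (w : Omega) : 'rV[R]_d :=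
  (beta * K%:R)^-1 *: (z - xloc t i z ci w K).

Definition Deltabar (t : nat) (z : 'rV[R]_d) (c : 'I_N -> 'rV[R]_d) (w : Omega)
  : 'rV[R]_d :=
  N%:R^-1 *: \sum_(i < N) Delta t i z (c i) w.

Fixpoint fstate (t : nat) (w : Omega) : 'rV[R]_d * ('I_N -> 'rV[R]_d) :=
  match t with
  | 0 => (z0, c0)
  | t'.+1 =>
      let zc := fstate t' w in
      let z := zc.1 in let c := zc.2 in
      let db := Deltabar t' z c w in
      (prox alpha h (z - alpha *: db),
       fun i => c i + db - Delta t' i z (c i) w)
  end.

Definition zit (t : nat) (w : Omega) : 'rV[R]_d := (fstate t w).1.
Definition cit (t : nat) (w : Omega) (i : 'I_N) : 'rV[R]_d := (fstate t w).2 i.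
End FedCanon.

Definition calE (R : realType) (d N : nat) (d1 : measure_display)
  (Omega : measurableType d1) (P : probability Omega R)
  (gf : 'I_N -> 'rV[R]_d -> 'rV[R]_d)
  (z : Omega -> 'rV[R]_d) (c : Omega -> 'I_N -> 'rV[R]_d) : \bar R :=
  ((N%:R^-1)%:E *
   \sum_(i < N) \int[P]_w (normsq (gf i (z w) + c w i - gavg gf (z w)))%:E)%E.

(* Main.v *)
(** The potential Psi_t = phi(z^t) - phi^* + alpha avg_i |grad f_i(z^t) + c_i^t - grad f(z^t)|^2
    contracts along every sample path, up to noise terms.  Since the control
    variables always sum to zero, the server step is a proximal step along the mean
    v of the v_i, and c_i^{t+1} = v - v_i.  With V = avg_i |v_i - grad f_i(z)|^2,
    strong convexity of the proximal objective, smoothness of f and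
    (1 - alpha rho)^-1-Lipschitz continuity of the proximal map give
    Psi_{t+1} <= phi(z^t) - phi^* + alpha (3 V - |G(z^t)|^2 / 4).
    The local drift contained in V is controlled by the previous control error, by the
    noise and by |grad f|^2 <= 2 |G|^2 + 2 B_h, so the PL inequality yields
    Psi_{t+1} <= (1 - alpha mu / 4) Psi_t + alpha (25/4 avg_i |n_i|^2 + 1/64 avg_{i,k} |e_{ik}|^2 + B_h / 8),
    where e_{ik} is the noise of one stochastic gradient and n_i = avg_k e_{ik}.
    It remains to see E|n_i|^2 <= sigma^2 / (B K), i.e. that the e_{ik} are orthogonal.
    Each sample is independent of the sigma-algebra generated by the past ones, so
    Tonelli's theorem for the joint law of past and fresh samples replaces conditional
    expectation; this needs joint measurability of the stochastic gradients, which
    holds because they are limits of difference quotients of Caratheodory functions. *)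

Require Import Defs.
From HB Require Import structures.
From mathcomp Require Import all_boot all_order all_algebra.
From mathcomp Require Import all_classical all_reals all_analysis.
From mathcomp Require Import measurable_realfun ring lra.
Import Order.TTheory GRing.Theory Num.Theory.
Import numFieldNormedType.Exports.
Local Open Scope classical_set_scope.
Local Open Scope ring_scope.
Set Implicit Arguments.
Unset Strict Implicit.
Unset Printing Implicit Defensive.

Ltac vring := apply/rowP => ?; rewrite !mxE; ring.

(** * Euclidean geometry of row vectors *)

Section Euclid.
Context {R : realType} {d : nat}.
Implicit Types (u v w : 'rV[R]_d) (a : R).

Lemma dotvC u v : dotv u v = dotv v u.
Proof. by apply: eq_bigr => j _; rewrite mulrC. Qed.

Lemma dotvDl u v w : dotv (u + v) w = dotv u w + dotv v w.
Proof. by rewrite -big_split; apply: eq_bigr => j _; rewrite !mxE mulrDl. Qed.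

Lemma dotvZl a u v : dotv (a *: u) v = a * dotv u v.
Proof. by rewrite mulr_sumr; apply: eq_bigr => j _; rewrite !mxE mulrA. Qed.

Lemma dotvDr u v w : dotv u (v + w) = dotv u v + dotv u w.
Proof. by rewrite dotvC dotvDl !(dotvC u). Qed.

Lemma dotvZr a u v : dotv u (a *: v) = a * dotv u v.
Proof. by rewrite dotvC dotvZl dotvC. Qed.

Lemma dotvNl u v : dotv (- u) v = - dotv u v.
Proof. by rewrite -scaleN1r dotvZl mulN1r. Qed.

Lemma dotvNr u v : dotv u (- v) = - dotv u v.
Proof. by rewrite dotvC dotvNl dotvC. Qed.

Lemma dotv0l u : dotv 0 u = 0.
Proof. by rewrite -(scale0r 0) dotvZl mul0r. Qed.

Lemma dotv_suml (I : Type) (s : seq I) (F : I -> 'rV[R]_d) u :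
  dotv (\sum_(i <- s) F i) u = \sum_(i <- s) dotv (F i) u.
Proof. by elim/big_rec2: _ => [|i x y _ <-]; rewrite ?dotv0l ?dotvDl. Qed.

Lemma normsqE u : normsq u = dotv u u.
Proof. by apply: eq_bigr => j _; rewrite expr2. Qed.

Lemma normsq_ge0 u : 0 <= normsq u.
Proof. by apply: sumr_ge0 => j _; exact: sqr_ge0. Qed.

Lemma normsqD u v : normsq (u + v) = normsq u + 2 * dotv u v + normsq v.
Proof. by rewrite !normsqE dotvDl !dotvDr (dotvC v u); ring. Qed.

Lemma normsqN u : normsq (- u) = normsq u.
Proof. by rewrite !normsqE dotvNl dotvNr opprK. Qed.

Lemma normsqB u v : normsq (u - v) = normsq u - 2 * dotv u v + normsq v.
Proof. by rewrite normsqD normsqN dotvNr; ring. Qed.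

Lemma normsqZ a u : normsq (a *: u) = a ^+ 2 * normsq u.
Proof. by rewrite !normsqE dotvZl dotvZr; ring. Qed.

Lemma normsq0 : normsq (0 : 'rV[R]_d) = 0.
Proof. by rewrite normsqE dotv0l. Qed.

Lemma normsqD_le u v : normsq (u + v) <= 2 * normsq u + 2 * normsq v.
Proof. by have := normsq_ge0 (u - v); rewrite normsqB normsqD; lra. Qed.

Lemma young_dotv a u v : 0 < a ->
  dotv u v <= a / 2 * normsq u + normsq v / (2 * a).
Proof.
move=> a0; have := normsq_ge0 (a *: u - v); rewrite normsqB normsqZ dotvZl => H.
rewrite -subr_ge0.
have -> : a / 2 * normsq u + normsq v / (2 * a) - dotv u v
  = (a ^+ 2 * normsq u - 2 * (a * dotv u v) + normsq v) / (2 * a).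
  by field; rewrite gt_eqF.
by rewrite divr_ge0// mulr_ge0// ltW.
Qed.

Lemma normsqD_ge u v : normsq u / 2 - normsq v <= normsq (u + v).
Proof. by have := normsqD_le (u + v) (- v); rewrite addrK normsqN; lra. Qed.

Definition avg (n : nat) (u : 'I_n -> 'rV[R]_d) := n%:R^-1 *: \sum_(i < n) u i.

(** The sum is [n] times the mean, so the cross term collapses. Both consequences matter for the
    control error: Jensen's inequality, and the bound of a variance by the second moment. *)
Lemma avg_variance n (u : 'I_n -> 'rV[R]_d) : (0 < n)%N ->
  n%:R^-1 * \sum_(i < n) normsq (u i - avg u)
  = n%:R^-1 * (\sum_(i < n) normsq (u i)) - normsq (avg u).
Proof.
move=> n0; have nn : n%:R != 0 :> R by rewrite pnatr_eq0 -lt0n.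
under eq_bigr do rewrite normsqB.
rewrite big_split sumrB /= -mulr_sumr -dotv_suml sumr_const card_ord.
have -> : \sum_(i < n) u i = n%:R *: avg u by rewrite scalerA mulfV// scale1r.
by rewrite dotvZl -normsqE -mulr_natl; field.
Qed.

Lemma normsq_avg n (u : 'I_n -> 'rV[R]_d) : (0 < n)%N ->
  normsq (avg u) <= n%:R^-1 * \sum_(i < n) normsq (u i).
Proof.
move=> n0; rewrite -subr_ge0 -avg_variance//.
by rewrite mulr_ge0 ?invr_ge0 ?ler0n ?sumr_ge0// => i _; exact: normsq_ge0.
Qed.

Lemma normsq_sum n (u : 'I_n -> 'rV[R]_d) :
  normsq (\sum_(i < n) u i) <= n%:R * \sum_(i < n) normsq (u i).
Proof.
case: n u => [u|n u]; first by rewrite !big_ord0 normsq0 mulr0.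
have nn : n.+1%:R != 0 :> R by rewrite pnatr_eq0.
have -> : \sum_(i < n.+1) u i = n.+1%:R *: avg u by rewrite scalerA mulfV// scale1r.
have n0 : 0 < n.+1%:R :> R by rewrite ltr0n.
rewrite normsqZ expr2 -mulrA ler_pM2l// -ler_pdivlMl//.
exact: normsq_avg.
Qed.

Lemma enorm_le u v a : 0 <= a -> enorm u <= a * enorm v ->
  normsq u <= a ^+ 2 * normsq v.
Proof.
move=> a0 /(lerXn2r 2) uv.
rewrite -(sqr_sqrtr (normsq_ge0 u)) -(sqr_sqrtr (normsq_ge0 v)) -exprMn.
by apply: uv; rewrite ?nnegrE ?mulr_ge0 ?sqrtr_ge0.
Qed.

Lemma enorm_sqr u : enorm u ^+ 2 = normsq u.
Proof. exact/sqr_sqrtr/normsq_ge0. Qed.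

(** The topology on row vectors comes from the sup norm; this transfers Euclidean estimates to
    it. *)
Lemma mx_norm_le_normsq u a : 0 <= a -> normsq u <= a ^+ 2 -> `|u| <= a.
Proof.
move=> a0 ua; rewrite [leLHS]/Num.norm/= mx_normrE.
apply/bigmax_leP; split => // -[i j] _ /=; rewrite (ord1 i).
rewrite -(@ler_pXn2r _ 2) ?nnegrE// (le_trans _ ua)// real_normK ?num_real//.
by rewrite /normsq (bigD1 j)//= lerDl sumr_ge0// => k _; exact: sqr_ge0.
Qed.

Lemma cvg_normsqB (x p : 'rV[R]_d) : normsq (y - p) @[y --> x] --> normsq (x - p).
Proof.
apply: (cvg_big add_continuous (nbhs_filter x)) => j _.
rewrite expr2 !mxE; under eq_fun do rewrite expr2 !mxE.
by apply: cvgM; (apply: cvgB; [exact: coord_continuous|exact: cvg_cst]).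
Qed.

Lemma near_normsq (p : 'rV[R]_d) a : 0 < a -> \forall x \near p, normsq (x - p) < a.
Proof.
move=> a0.
have := cvgr_lt (normsq (p - p)) (@cvg_normsqB p p) a.
by rewrite subrr normsq0; exact.
Qed.

End Euclid.
(** * Proximal operator of a weakly convex function *)

Section Prox.
Context {R : realType} {d : nat}.
Variables (h : 'rV[R]_d -> \bar R) (hr : 'rV[R]_d -> R) (rho alpha : R).
Hypothesis hE : forall z, h z = (hr z)%:E.
Hypothesis h_lsc : lsc h.
Hypothesis h_wc : weakly_convex rho h.
Hypotheses (alpha0 : 0 < alpha) (ar1 : alpha * rho < 1).

Let obj (y x : 'rV[R]_d) : R := hr x + normsq (x - y) / (2 * alpha).

Hypothesis obj_lb : forall y, exists m, forall x, m <= obj y x.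

Lemma is_proxP y p : is_prox alpha h y p <-> forall x, obj y p <= obj y x.
Proof.
by split=> H x; have := H x; rewrite /obj !hE -!EFinD lee_fin.
Qed.

Lemma normsq_segment (x p y : 'rV[R]_d) (l : R) :
  normsq (l *: x + (1 - l) *: p - y)
  = l * normsq (x - y) + (1 - l) * normsq (p - y) - l * (1 - l) * normsq (x - p).
Proof.
have -> : x - p = (x - y) - (p - y) by rewrite opprB addrA subrK.
have -> : l *: x + (1 - l) *: p - y = l *: (x - y) + (1 - l) *: (p - y).
  by rewrite !scalerBr scalerBl scale1r -!addrA; congr (_ + _);
     apply/rowP => j; rewrite !mxE; ring.
by rewrite (normsqB (x - y)) (normsqD (l *: _)) !normsqZ dotvZl dotvZr; ring.
Qed.

(** The proximal quadratic contributes modulus [alpha^-1] through the identity [normsq_segment]; the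
    same identity at the origin turns the convexity of [h] plus its quadratic into a loss of
    [rho]. *)
Lemma obj_strongly_convex y x p l : 0 <= l <= 1 ->
  obj y (l *: x + (1 - l) *: p) <= l * obj y x + (1 - l) * obj y p
    - l * (1 - l) * ((alpha^-1 - rho) / 2 * normsq (x - p)).
Proof.
move=> l01; have := h_wc x p l01; rewrite /= !hE -!EFinD lee_fin.
have := normsq_segment x p 0 l; rewrite !subr0 => -> H.
rewrite /obj normsq_segment invfM.
by move: H; set a := alpha^-1; lra.
Qed.

Let gap0 : 0 < (alpha^-1 - rho) / 2.
Proof.
rewrite divr_gt0// subr_gt0 -(ltr_pM2l alpha0) mulfV//.
by rewrite gt_eqF.
Qed.

(* A minimizing sequence is Cauchy by strong convexity at midpoints. *)
Lemma prox_exists y : exists p, is_prox alpha h y p.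
Proof.
have [m0 m0P] := obj_lb y.
pose E := range (obj y); pose m := inf E.
have Elb : has_lbound E by exists m0 => _ [x _ <-].
have Einf : has_inf E by split => //; exists (obj y 0); exists 0.
have mle x : m <= obj y x by apply: ge_inf => //; exists x.
(* At a midpoint, strong convexity subtracts exactly [c * normsq (u n - u k)]. Points optimal up to
   [c / (n+1)^2] then make [c] cancel. *)
pose c := (alpha^-1 - rho) / 8.
have c0 : 0 < c by move: gap0; rewrite /c; lra.
have exx (n : nat) : exists x, obj y x < m + c * n.+1%:R^-1 ^+ 2.
  have s0 : 0 < n.+1%:R^-1 :> R by rewrite invr_gt0 ltr0n.
  have [_ [x _ <-] xlt] := inf_adherent (mulr_gt0 c0 (exprn_gt0 2 s0)) Einf.
  by exists x.
have [u uP] := choice exx.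
have ucl n k : normsq (u n - u k) <= n.+1%:R^-1 ^+ 2 + k.+1%:R^-1 ^+ 2.
  have hh : 0 <= (2^-1 : R) <= 1 by apply/andP; split; lra.
  have := obj_strongly_convex y (u n) (u k) hh.
  have := mle (2^-1 *: u n + (1 - 2^-1) *: u k).
  have := uP n; have := uP k.
  set s := _ ^+ 2; set t := _ ^+ 2; set q := normsq _ => H1 H2 H3 H4.
  have cE : (alpha^-1 - rho) / 2 = 4 * c by rewrite /c; lra.
  rewrite -(ler_pM2l c0); move: H1 H2 H4; rewrite cE; clear cE; clearbody c.
  move: H3; set o1 := obj _ _; set o2 := obj _ (u k); set o3 := obj _ (u n).
  have : 0 <= c * s by rewrite mulr_ge0 ?sqr_ge0// ltW.
  have : 0 <= c * t by rewrite mulr_ge0 ?sqr_ge0// ltW.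
  lra.
have uC : cauchy (u @ \oo).
  apply: cauchy_exP => e e0.
  have [k ke] : exists k : nat, 2 * k.+1%:R^-1 < e.
    have e20 : 0 < e / 2 by rewrite divr_gt0.
    have [k _ /(_ k (leqnn k))] := near_infty_natSinv_lt (PosNum e20).
    by move=> /= ke; exists k; rewrite mulrC -ltr_pdivlMr.
  exists (u k); exists k => // n /= kn.
  rewrite -ball_normE /ball_/=; apply: le_lt_trans ke.
  apply: mx_norm_le_normsq; first by rewrite mulr_ge0.
  apply: (le_trans (ucl k n)).
  have : n.+1%:R^-1 ^+ 2 <= k.+1%:R^-1 ^+ 2 :> R.
    by rewrite lerXn2r ?nnegrE// lef_pV2 ?posrE ?ltr0n// ler_nat.
  have := sqr_ge0 (k.+1%:R^-1 : R); rewrite exprMn (_ : 2 ^+ 2 = 4 :> R); last by ring.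
  by set a := _ ^+ 2; set b := _ ^+ 2; lra.
have /cvg_ex[p up] : cvg (u @ \oo) by exact/cauchy_cvgP.
exists p; apply/is_proxP => x; apply: le_trans (mle x).
rewrite leNgt; apply/negP => mp.
(* Lower semicontinuity of [h], continuity of the quadratic and the accuracy of [u n] each lose at
   most [e]; three losses cannot fill the gap [4 * e]. *)
pose e := (obj y p - m) / 4.
have e0 : 0 < e by rewrite divr_gt0// subr_gt0.
have : \forall n \near \oo, ((hr p - e)%:E < h (u n))%E.
  have lh : \forall x \near p, ((hr p - e)%:E < h x)%E.
    by apply: h_lsc; rewrite hE lte_fin ltrBlDr ltrDl.
  exact: (up _ lh).
have a20 : 0 < 2 * alpha by rewrite mulr_gt0.
have : \forall n \near \oo, normsq (p - y) / (2 * alpha) - e < normsq (u n - y) / (2 * alpha).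
  have qc := cvg_comp _ _ up (@cvg_normsqB R d p y).
  have : normsq (p - y) - 2 * alpha * e < normsq (p - y).
    by rewrite ltrBlDr ltrDl mulr_gt0.
  move=> /(cvgr_gt _ qc); apply: filterS => n /= H.
  rewrite (_ : _ - e = (normsq (p - y) - 2 * alpha * e) / (2 * alpha)).
    by rewrite ltr_pM2r ?invr_gt0.
  by field; rewrite gt_eqF.
have : \forall n \near \oo, c * n.+1%:R^-1 ^+ 2 < e.
  have ec0 : 0 < e / c by rewrite divr_gt0.
  have := near_infty_natSinv_lt (PosNum ec0); apply: filterS => n /= ne.
  rewrite mulrC -ltr_pdivlMr//; apply: le_lt_trans ne.
  by rewrite expr2 ler_piMl ?invr_ge0// invf_le1 ?ltr0n// ler1n.
move=> H1 H2 H3.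
have [n _ /(_ n (leqnn n)) [[{}H1 {}H2] {}H3]] := filterI (filterI H1 H2) H3.
move: H3; rewrite hE lte_fin => H3.
have eE : 4 * e = obj y p - m by rewrite /e; lra.
have := uP n; move: eE mp H1 H2 H3; rewrite /obj; clearbody e.
by set s := c * _; set q := _ / (2 * alpha); set q' := _ / (2 * alpha); lra.
Unshelve. all: by end_near. Qed.

Lemma proxP y : is_prox alpha h y (prox alpha h y).
Proof. by have [p yp] := prox_exists y; exact: (xgetI _ yp). Qed.

(** Strong convexity on the segment from the minimizer to [x], divided by [l], gives this growth up
    to the factor [1 - l]; then [l] is made small. *)
Lemma prox_strong_min y x :
  obj y (prox alpha h y) + (alpha^-1 - rho) / 2 * normsq (x - prox alpha h y)
  <= obj y x.
Proof.
have /is_proxP := proxP y; set p := prox _ _ _ => pmin.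
set q := _ / 2 * normsq _; have q0 : 0 <= q by rewrite mulr_ge0 ?normsq_ge0// ltW.
apply/ler_addgt0Pr => e e0.
(* Small enough that [l * q <= e]; the [+ 1] covers [q = 0]. *)
pose l : R := Num.min 1 (e / (q + 1)).
have q10 : 0 < q + 1 by lra.
have l0 : 0 < l by rewrite lt_min ltr01 divr_gt0.
have l1 : l <= 1 by rewrite ge_min lexx.
have le : l * q <= e.
  apply: (@le_trans _ _ (e / (q + 1) * q)).
    by rewrite ler_wpM2r// ge_min lexx orbT.
  by rewrite -mulrAC ler_pdivrMr// ler_pM2l//; lra.
have l01 : 0 <= l <= 1 by rewrite l1 ltW.
have := le_trans (pmin _) (obj_strongly_convex y x p l01).
rewrite -/q => H.
have : l * (obj y p + (1 - l) * q) <= l * obj y x by lra.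
by rewrite ler_pM2l//; lra.
Qed.

(** Adding the quadratic growth at both proximal points gives [s * normsq (p - p') <= dotv (y - y')
    (p - p')] with [s = 1 - alpha * rho]. Expanding [0 <= normsq (y - y' - s *: (p - p'))] then
    plays the role of Cauchy-Schwarz. *)
Lemma prox_lipschitz y y' :
  (1 - alpha * rho) ^+ 2 * normsq (prox alpha h y - prox alpha h y')
  <= normsq (y - y').
Proof.
have := prox_strong_min y (prox alpha h y').
have := prox_strong_min y' (prox alpha h y).
rewrite /obj; set p := prox _ _ y; set p' := prox _ _ y'.
have -> : normsq (p' - p) = normsq (p - p') by rewrite -normsqN opprB.
rewrite invfM => H1 H2.
rewrite !(normsqB _ y) in H2; rewrite !(normsqB _ y') in H1.
set s := 1 - alpha * rho; have s0 : 0 < s by rewrite subr_gt0.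
have H3 : s * normsq (p - p') <= dotv (y - y') (p - p').
  rewrite dotvDl !dotvNl !dotvDr !dotvNr.
  rewrite (dotvC y p) (dotvC y p') (dotvC y' p) (dotvC y' p').
  have a0 : alpha^-1 * alpha = 1 by rewrite mulVf// gt_eqF.
  rewrite -(@ler_pM2l _ alpha^-1) ?invr_gt0// mulrA /s mulrBr mulr1 mulrA a0 mul1r.
  by move: H1 H2; set a := alpha^-1; lra.
have := normsq_ge0 (y - y' - s *: (p - p')).
rewrite (normsqB (y - y')) normsqZ dotvZr.
move: H3; set A := normsq _; set B := dotv _ _; set C := normsq _ => H3 H4.
have : s * (s * A) <= s * B by rewrite ler_pM2l.
by rewrite !expr2 in H4 *; lra.
Qed.

(** [subgrad] is the Frechet subdifferential. Minimality leaves only the remainder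
    [normsq (x - p) / (2 * alpha)], which is at most [e * enorm (x - p)] once
    [enorm (x - p) <= 2 * alpha * e]. *)
Lemma subgrad_prox y :
  subgrad h (prox alpha h y) (alpha^-1 *: (y - prox alpha h y)).
Proof.
have /is_proxP := proxP y; set p := prox _ _ _ => pmin.
split=> [|e e0]; first by rewrite hE.
have ae0 : 0 < (2 * alpha * e) ^+ 2 by rewrite exprn_gt0// !mulr_gt0.
near=> x; rewrite !hE -EFinD lee_fin.
have := pmin x; rewrite /obj.
have -> : normsq (x - y) = normsq (x - p) - 2 * dotv (y - p) (x - p) + normsq (p - y).
  have -> : x - y = (x - p) - (y - p) by rewrite opprB addrA subrK.
  by rewrite (normsqB (x - p)) (dotvC (y - p)) -(normsqN (p - y)) opprB.
have : normsq (x - p) / (2 * alpha) <= e * enorm (x - p).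
  rewrite ler_pdivrMr ?mulr_gt0// -enorm_sqr expr2 mulrAC.
  rewrite ler_wpM2r ?sqrtr_ge0//.
  rewrite -(@ler_pXn2r _ 2) ?nnegrE ?sqrtr_ge0//; last by rewrite !mulr_ge0// ltW.
  rewrite enorm_sqr (mulrC e); apply: ltW.
  by near: x; exact: near_normsq.
rewrite dotvZl invfM.
set N1 := normsq _; set N2 := enorm _; set N3 := normsq _; set D := dotv _ _.
by set a := alpha^-1; lra.
Unshelve. all: by end_near. Qed.

End Prox.
(** * One communication round along a sample path *)

Section LocalDrift.
Context {R : realType} {d : nat}.
Variables (g : 'rV[R]_d -> 'rV[R]_d) (x e : nat -> 'rV[R]_d) (c : 'rV[R]_d).
Variables (beta L : R) (K : nat).
Hypothesis gL : forall y y', normsq (g y - g y') <= L ^+ 2 * normsq (y - y').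
Hypothesis xS : forall k, x k.+1 = x k - beta *: (g (x k) + e k + c).

(** Splits the displacement into noise, change of the gradient, and the fixed direction
    [g (x 0) + c], which are estimated separately. *)
Lemma local_path k :
  x k - x 0%N = - beta *: \sum_(j < k) (e j + (g (x j) - g (x 0%N)) + (g (x 0%N) + c)).
Proof.
elim: k => [|k IH]; first by rewrite big_ord0 scaler0 subrr.
rewrite big_ord_recr/= scalerDr -IH xS -addrA [in LHS]addrC -addrA addrC.
rewrite -!scaleNr; congr (_ + _).
  by rewrite addrC.
congr (_ *: _); rewrite -!addrA [LHS]addrCA; congr (_ + _).
by rewrite !addrA subrK.
Qed.

Lemma sum_iota_le n : \sum_(k < n) (k%:R : R) <= n%:R ^+ 2 / 2.
Proof.
elim: n => [|n IH]; first by rewrite big_ord0 expr2 !mul0r.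
by rewrite big_ord_recr/= -natr1; move: IH; set a := \sum_(_ < _) _; nra.
Qed.

(** Cauchy-Schwarz costs [k], the three-term split a factor 3, and summing [k] gives [K^2 / 2]. So
    the left side X satisfies [X <= 3/2 * kap * (X + Y)]; since [kap <= 1/1152], the X on the right
    is absorbed and 3/2 rises to at most 2. *)
Lemma local_drift : beta ^+ 2 * K%:R ^+ 2 * L ^+ 2 <= 1 / 1152 ->
  L ^+ 2 * \sum_(k < K) normsq (x k - x 0%N)
  <= 2 * (beta ^+ 2 * K%:R ^+ 2 * L ^+ 2)
     * (\sum_(k < K) normsq (e k) + K%:R * normsq (g (x 0%N) + c)).
Proof.
set kap := _ * L ^+ 2 => kap1.
set S := \sum_(k < K) normsq (x k - _); set E := \sum_(k < K) normsq (e k).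
set b := normsq _.
have S0 : 0 <= S by apply: sumr_ge0 => k _; exact: normsq_ge0.
have E0 : 0 <= E by apply: sumr_ge0 => k _; exact: normsq_ge0.
have b0 : 0 <= b by exact: normsq_ge0.
(* One bound for all steps at once; it contains the unknown sum [S], which is why an absorption
   argument must follow. *)
pose M := E + L ^+ 2 * S + K%:R * b.
have M0 : 0 <= M by rewrite /M addr_ge0 ?addr_ge0// mulr_ge0 ?sqr_ge0 ?ler0n.
have qk (k : 'I_K) : normsq (x k - x 0%N) <= k%:R * (3 * beta ^+ 2 * M).
  rewrite local_path normsqZ sqrrN.
  rewrite (_ : k%:R * (3 * beta ^+ 2 * M) = beta ^+ 2 * (k%:R * (3 * M))); last by ring.
  rewrite ler_wpM2l ?sqr_ge0//.
  apply: (le_trans (normsq_sum _)); rewrite ler_wpM2l//.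
  apply: (@le_trans _ _ (\sum_(j < k) 3 * (normsq (e j) + L ^+ 2 * normsq (x j - x 0%N) + b))).
    apply: ler_sum => j _; apply: (le_trans _ (ler_wpM2l _ (lerD (lerD (lexx _) (gL _ _)) (lexx _)))) => //.
    have := normsq_ge0 (e j - (g (x j) - g (x 0%N))).
    have := normsq_ge0 (e j - (g (x 0%N) + c)).
    have := normsq_ge0 (g (x j) - g (x 0%N) - (g (x 0%N) + c)).
    rewrite /b; set A := e j; set B := g (x j) - _; set C := g _ + c.
    rewrite (normsqB B C) (normsqB A C) (normsqB A B) (normsqD (A + B)) (normsqD A) dotvDl.
    set a1 := normsq _; set a2 := normsq _; set a3 := normsq _.
    set t1 := dotv _ _; set t2 := dotv _ _; set t3 := dotv _ _.
    by lra.
  rewrite -mulr_sumr ler_wpM2l// /M /E /S.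
  have le_ord (F : nat -> R) : (forall j, 0 <= F j) -> \sum_(j < k) F j <= \sum_(j < K) F j.
    move=> F0; rewrite (big_ord_widen K F (ltnW (ltn_ord k))) [leRHS](bigID (fun j : 'I_K => (j < k)%N))/=.
    by rewrite lerDl sumr_ge0.
  rewrite big_split big_split/= -mulr_sumr.
  have -> : \sum_(j < k) b = k%:R * b by rewrite sumr_const card_ord mulr_natl.
  rewrite lerD//; last by rewrite ler_wpM2r// ler_nat ltnW.
  rewrite lerD//; first by apply: (le_ord (fun j => normsq (e j))) => j; exact: normsq_ge0.
  rewrite ler_wpM2l ?sqr_ge0//.
  by apply: (le_ord (fun j => normsq (x j - x 0%N))) => j; exact: normsq_ge0.
have SM : L ^+ 2 * S <= 3 / 2 * kap * M.
  have : S <= K%:R ^+ 2 / 2 * (3 * beta ^+ 2 * M).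
    apply: (@le_trans _ _ (\sum_(k < K) k%:R * (3 * beta ^+ 2 * M))); first exact: ler_sum.
    by rewrite -mulr_suml ler_wpM2r ?sum_iota_le// mulr_ge0// mulr_ge0 ?sqr_ge0.
  move=> /(ler_wpM2l (sqr_ge0 L)) /le_trans; apply.
  by rewrite le_eqVlt; apply/orP; left; apply/eqP; rewrite /kap; field.
have kap0 : 0 <= kap by rewrite /kap mulr_ge0 ?sqr_ge0// mulr_ge0 ?sqr_ge0.
have X0 : 0 <= L ^+ 2 * S by rewrite mulr_ge0 ?sqr_ge0.
have Y0 : 0 <= E + K%:R * b by rewrite addr_ge0 ?mulr_ge0.
move: SM X0 Y0; rewrite /M (addrAC E).
set X := L ^+ 2 * S; set Y := E + _ => XM X0 Y0.
have : kap * X <= 1 / 1152 * X by rewrite ler_wpM2r.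
have : 0 <= kap * Y by rewrite mulr_ge0.
by move: XM; rewrite mulrDr -!mulrA; nra.
Qed.

(** The step size cancels and [c] enters only additively. Averaging over clients thus removes
    control variables of zero sum, and the control update leaves the mean of the [v_i] minus
    [v_i]. *)
Lemma local_average : beta != 0 -> (0 < K)%N ->
  (beta * K%:R)^-1 *: (x 0%N - x K) = avg (fun k : 'I_K => g (x k) + e k) + c.
Proof.
move=> b0 K0; have nK : K%:R != 0 :> R by rewrite pnatr_eq0 -lt0n.
rewrite -opprB local_path scaleNr opprK scalerA invfM mulrAC mulVf// mul1r.
have -> : \sum_(j < K) (e j + (g (x j) - g (x 0%N)) + (g (x 0%N) + c))
  = \sum_(j < K) (g (x j) + e j) + K%:R *: c.
  rewrite scaler_nat -[X in _ *+ X]card_ord -sumr_const -big_split/=.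
  by apply: eq_bigr => j _; vring.
by rewrite scalerDr scalerA mulVf// scale1r.
Qed.

End LocalDrift.

(** * Descent of the potential in one server step *)

Section OneStep.
Context {R : realType} {d N : nat}.
Variables (f : 'I_N -> 'rV[R]_d -> R) (gf : 'I_N -> 'rV[R]_d -> 'rV[R]_d).
Variables (h : 'rV[R]_d -> \bar R) (hr : 'rV[R]_d -> R) (rho alpha L Bh : R).
Hypothesis hE : forall z, h z = (hr z)%:E.
Hypothesis h_lsc : lsc h.
Hypothesis h_wc : weakly_convex rho h.
Hypotheses (alpha0 : 0 < alpha) (L0 : 0 < L) (N0 : (0 < N)%N).
Hypothesis obj_lb : forall y, exists m, forall x,
  m <= hr x + normsq (x - y) / (2 * alpha).
Hypothesis f_smooth : forall i x y,
  f i x - f i y - dotv (gf i y) (x - y) <= L / 2 * normsq (x - y).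
Hypothesis gfL : forall i x y, normsq (gf i x - gf i y) <= L ^+ 2 * normsq (x - y).
Hypothesis subB : forall z v, subgrad h z v -> normsq v <= Bh.
Hypothesis step : alpha * (rho + L) + 4 * alpha ^+ 2 * L ^+ 2 <= 1 / 2.

Let nN : N%:R != 0 :> R. Proof. by rewrite pnatr_eq0 -lt0n. Qed.
Let iN0 : 0 < N%:R^-1 :> R. Proof. by rewrite invr_gt0 ltr0n. Qed.

(** Makes the Lipschitz constant of the proximal map at most 2, the source of the factor 4 in
    [Gmap_perturb]. *)
Lemma step_rho : alpha * rho <= 1 / 2.
Proof.
have : 0 <= alpha * L by rewrite mulr_ge0// ltW.
have : 0 <= alpha ^+ 2 * L ^+ 2 by rewrite mulr_ge0 ?sqr_ge0.
by move: step; rewrite mulrDr -!mulrA; lra.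
Qed.

Let ar1 : alpha * rho < 1. Proof. by have := step_rho; lra. Qed.

Lemma favg_smooth x y :
  favg f x <= favg f y + dotv (gavg gf y) (x - y) + L / 2 * normsq (x - y).
Proof.
rewrite /favg /gavg dotvZl dotv_suml.
have -> : L / 2 * normsq (x - y) = N%:R^-1 * (\sum_(i < N) (L / 2 * normsq (x - y))).
  rewrite (_ : \sum_(i < N) _ = N%:R * (L / 2 * normsq (x - y))).
    by rewrite [RHS]mulrA mulVf// mul1r.
  by rewrite sumr_const card_ord mulr_natl.
rewrite -!mulrDr -!big_split/= ler_pM2l//; apply: ler_sum => i _.
by have := f_smooth i x y; lra.
Qed.

(** The difference [Gmap - gavg] is the subgradient of [h] supplied by [subgrad_prox] at the
    proximal point, hence bounded by [Bh]. *)
Lemma grad_bound z :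
  normsq (gavg gf z) <= 2 * normsq (Gmap alpha h gf z) + 2 * Bh.
Proof.
have /subB := subgrad_prox hE h_lsc h_wc alpha0 ar1 obj_lb (z - alpha *: gavg gf z).
set u := gavg gf z; set p := prox _ _ _.
rewrite (_ : alpha^-1 *: (z - alpha *: u - p) = Gmap alpha h gf z - u) => [H|]; last first.
  rewrite /Gmap -/u -/p; generalize u p => u' p'.
  by apply/rowP => j; rewrite !mxE; field; rewrite gt_eqF.
have := normsqD_le (Gmap alpha h gf z) (u - Gmap alpha h gf z).
by rewrite addrC subrK -(normsqN (u - _)) opprB; lra.
Qed.

(** Smoothness of f is added to the quadratic growth of the proximal objective compared at [p] and
    [z]. Half of the weight 1 of [normsq Gt] comes from the proximal quadratic and half from strong
    convexity. *)
Lemma prox_descent z u p Gt :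
  p = prox alpha h (z - alpha *: u) -> Gt = alpha^-1 *: (z - p) ->
  favg f p + hr p <= favg f z + hr z + alpha * (dotv (u - gavg gf z) Gt
     - (1 - alpha * (rho + L) / 2) * normsq Gt).
Proof.
move=> pE GtE.
have zp : z - p = alpha *: Gt by rewrite GtE scalerA mulfV ?gt_eqF// scale1r.
have pz : p - z = - (alpha *: Gt) by rewrite -zp opprB.
have := prox_strong_min hE h_lsc h_wc alpha0 ar1 obj_lb (z - alpha *: u) z.
rewrite -pE (_ : z - (z - alpha *: u) = alpha *: u); last by vring.
have -> : p - (z - alpha *: u) = alpha *: (u - Gt).
  by rewrite scalerBr -zp; vring.
have := favg_smooth p z; rewrite zp pz !normsqN !normsqZ dotvNr dotvZr.
rewrite dotvDl dotvNl (normsqB u).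
set a := favg f p; set b := favg f z; set D := dotv (gavg _ _) _; set E := dotv u Gt.
set n := normsq Gt; set m := normsq u.
have -> : (alpha^-1 - rho) / 2 * (alpha ^+ 2 * n) = (1 - alpha * rho) / 2 * alpha * n.
  by field; rewrite gt_eqF.
have -> : alpha ^+ 2 * (m - 2 * E + n) / (2 * alpha) = alpha * (m - 2 * E + n) / 2.
  by field; rewrite gt_eqF.
have -> : alpha ^+ 2 * m / (2 * alpha) = alpha * m / 2.
  by field; rewrite gt_eqF.
by lra.
Qed.

Lemma Gmap_perturb z u :
  normsq (Gmap alpha h gf z - alpha^-1 *: (z - prox alpha h (z - alpha *: u)))
  <= 4 * normsq (u - gavg gf z).
Proof.
have -> : Gmap alpha h gf z - alpha^-1 *: (z - prox alpha h (z - alpha *: u))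
  = alpha^-1 *: (prox alpha h (z - alpha *: u) - prox alpha h (z - alpha *: gavg gf z)).
  by rewrite /Gmap; move: (prox _ _ _) (prox _ _ _) => p q; vring.
rewrite normsqZ.
have := prox_lipschitz hE h_lsc h_wc alpha0 ar1 obj_lb
   (z - alpha *: u) (z - alpha *: gavg gf z).
have -> : z - alpha *: u - (z - alpha *: gavg gf z) = - alpha *: (u - gavg gf z).
  by generalize (gavg gf z) => w; vring.
rewrite normsqZ sqrrN; set q := normsq (_ - _); set e := normsq _ => H.
have e0 : 0 <= e by exact: normsq_ge0.
have q0 : 0 <= q by exact: normsq_ge0.
have q4 : q / 4 <= alpha ^+ 2 * e.
  apply: le_trans H; rewrite mulrC ler_wpM2r//.
  have s2 : 1 / 2 <= 1 - alpha * rho by have := step_rho; lra.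
  by nra.
rewrite exprVn ler_pdivrMl ?exprn_gt0//; lra.
Qed.

(* The new control error is a variance over the clients, hence is at most
   2 alpha^2 L^2 |Gt|^2 + 2 (V - |e|^2), where e is the mean of v_i - grad f_i(z) and Gt
   the perturbed gradient map.  Keeping the term - 2 |e|^2 is what makes 3 V suffice
   although Gmap_perturb costs a factor 4. *)
Lemma one_step z (v : 'I_N -> 'rV[R]_d) p V :
  p = prox alpha h (z - alpha *: avg v) ->
  V = N%:R^-1 * \sum_(i < N) normsq (gf i z - v i) ->
  favg f p + hr p
    + alpha * (N%:R^-1 * \sum_(i < N) normsq (gf i p + (avg v - v i) - gavg gf p))
  <= favg f z + hr z + alpha * (- (normsq (Gmap alpha h gf z) / 4) + 3 * V).
Proof.
move=> pE VE; pose Gt := alpha^-1 *: (z - p).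
pose y i := gf i z - v i; pose w i := gf i p - gf i z.
have yE : avg y = - (avg v - gavg gf z).
  by rewrite /avg sumrB scalerBr opprB.
have wE : avg w = gavg gf p - gavg gf z by rewrite /avg sumrB scalerBr.
have zp : p - z = - (alpha *: Gt).
  by rewrite scalerA mulfV ?gt_eqF// scale1r opprB.
have W : N%:R^-1 * \sum_(i < N) normsq (w i - avg w) <= alpha ^+ 2 * L ^+ 2 * normsq Gt.
  rewrite avg_variance//; apply: (@le_trans _ _ (N%:R^-1 * \sum_(i < N) normsq (w i))).
    by rewrite gerBl normsq_ge0.
  rewrite mulrC ler_pdivrMr ?ltr0n//.
  have -> : alpha ^+ 2 * L ^+ 2 * normsq Gt * N%:R = \sum_(i < N) (alpha ^+ 2 * L ^+ 2 * normsq Gt).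
    by rewrite sumr_const card_ord mulr_natr.
  apply: ler_sum => i _; apply: (le_trans (gfL i _ _)).
  by rewrite zp normsqN normsqZ mulrCA mulrA.
have Y : N%:R^-1 * \sum_(i < N) normsq (y i - avg y) = V - normsq (avg v - gavg gf z).
  by rewrite avg_variance// yE normsqN VE.
have eV : normsq (avg v - gavg gf z) <= V.
  by rewrite -normsqN -yE VE; exact: normsq_avg.
(* The new control error is the deviation of [w i + y i] from its mean: [w] from moving [z] to [p],
   [y] from the inexactness of [v]. *)
have E : N%:R^-1 * \sum_(i < N) normsq (gf i p + (avg v - v i) - gavg gf p)
  <= 2 * (alpha ^+ 2 * L ^+ 2 * normsq Gt) + 2 * (V - normsq (avg v - gavg gf z)).
  rewrite -Y; apply: (le_trans _ (lerD (ler_wpM2l _ W) (lexx _))) => //.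
  rewrite !(mulrCA 2) -mulrDr ler_pM2l// !mulr_sumr -big_split/=; apply: ler_sum => i _.
  apply: (le_trans _ (normsqD_le _ _)).
  rewrite le_eqVlt; apply/orP; left; apply/eqP; congr normsq.
  by rewrite yE wE /y /w; apply/rowP => j; rewrite !mxE; ring.
have := prox_descent pE (erefl Gt).
have := Gmap_perturb z (avg v); rewrite -pE -/Gt.
have := normsqD_ge (Gmap alpha h gf z) (Gt - Gmap alpha h gf z).
rewrite [in X in _ <= X -> _]addrC subrK -(normsqN (Gt - _)) opprB.
have := young_dotv (avg v - gavg gf z) Gt (ltr0Sn R 1).
move: E eV; set e := normsq (avg v - _); set D := dotv _ _; set g := normsq Gt.
set G := normsq (Gmap _ _ _ _); set GG := normsq (_ - Gt); set EE := N%:R^-1 * _.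
move=> E eV H1 H2 H3 H4.
have g0 : 0 <= g by exact: normsq_ge0.
have : (alpha * (rho + L) + 4 * alpha ^+ 2 * L ^+ 2) * g <= 1 / 2 * g by rewrite ler_wpM2r.
rewrite mulrDl => H5.
(* Young gives [D <= e + g / 4], and half of the step-size condition costs another [g / 4], so
   [2 * V - e - g / 2] remains. With [g >= G / 2 - 4 * e] this is at most [2 * V + e - G / 4], and
   [e <= V]. *)
have : alpha * (EE + D - (1 - alpha * (rho + L) / 2) * g) <= alpha * (- (G / 4) + 3 * V).
  rewrite ler_pM2l//.
  have : (1 - alpha * (rho + L) / 2) * g = g - alpha * (rho + L) * g / 2 by field.
  move: E H5; rewrite -mulrA; set Q := alpha ^+ 2 * L ^+ 2; rewrite -(mulrA 4).
  set Qg := Q * g; set Sg := alpha * (rho + L) * g; lra.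
by move: H4; lra.
Qed.

Variables (mu ps beta : R) (K : nat).
Hypothesis K0 : (0 < K)%N.
Hypothesis PL : forall z, 2 * mu * (favg f z + hr z - ps) <= normsq (Gmap alpha h gf z).
Let kap := beta ^+ 2 * K%:R ^+ 2 * L ^+ 2.
Hypotheses (kap_small : kap <= 1 / 1152) (kap_rate : 24 * kap <= 1 - alpha * mu / 4).

Section Round.
Variables (z : 'rV[R]_d) (c : 'I_N -> 'rV[R]_d) (x e : 'I_N -> nat -> 'rV[R]_d).
Hypothesis x0 : forall i, x i 0%N = z.
Hypothesis xS : forall i k, x i k.+1 = x i k - beta *: (gf i (x i k) + e i k + c i).

Let v i := avg (fun k : 'I_K => gf i (x i k) + e i k).
Let n i := avg (fun k : 'I_K => e i k).
Let a i := gf i z + c i - gavg gf z.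
Let Q i := K%:R^-1 * \sum_(k < K) normsq (e i k).

Let kap0 : 0 <= kap. Proof. by rewrite /kap mulr_ge0 ?sqr_ge0// mulr_ge0 ?sqr_ge0. Qed.
Let nK : K%:R != 0 :> R. Proof. by rewrite pnatr_eq0 -lt0n. Qed.

(** [v i] deviates from [gf i z] by the mean noise [n i] and by the mean gradient change [r] along
    the local path. [local_drift] bounds [r], with its fixed direction rewritten as the control
    error [a i] plus the full gradient. *)
Lemma client_error i : normsq (gf i z - v i)
  <= 2 * normsq (n i) + 4 * kap * (Q i + 2 * normsq (a i) + 2 * normsq (gavg gf z)).
Proof.
pose r := avg (fun k : 'I_K => gf i (x i k) - gf i z).
have vE : gf i z - v i = - (n i + r).
  have gE : K%:R^-1 *: (gf i z *+ K) = gf i z.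
    by rewrite -[gf i z *+ K]scaler_nat scalerA mulVf// scale1r.
  rewrite /v /n /r /avg sumrB big_split/= sumr_const card_ord scalerBr gE scalerDr.
  by vring.
have rK : normsq r <= K%:R^-1 * (L ^+ 2 * \sum_(k < K) normsq (x i k - x i 0%N)).
  apply: (le_trans (normsq_avg _ K0)); rewrite ler_wpM2l ?invr_ge0 ?ler0n// mulr_sumr.
  by apply: ler_sum => k _; rewrite x0; exact: gfL.
have := local_drift (gfL i) (xS i) kap_small; rewrite x0 -/kap => drift.
have rQ : normsq r <= 2 * kap * (Q i + normsq (gf i z + c i)).
  apply: (le_trans rK); rewrite x0 mulrC ler_pdivrMr ?ltr0n//.
  apply: (le_trans drift); rewrite -[leRHS]mulrA [(Q i + _) * _]mulrDl.
  by rewrite /Q (mulrC K%:R^-1) divfK// (mulrC K%:R).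
have bE : normsq (gf i z + c i) <= 2 * normsq (a i) + 2 * normsq (gavg gf z).
  by have := normsqD_le (a i) (gavg gf z); rewrite /a subrK.
have := normsqD_le (n i) r; rewrite vE normsqN.
have : kap * normsq (gf i z + c i) <= kap * (2 * normsq (a i) + 2 * normsq (gavg gf z)).
  by rewrite ler_wpM2l.
move: rQ; set q := normsq (gf i z + c i); set nn := normsq (n i); set rr := normsq r.
by set s := normsq (n i + r); rewrite !(mulrDr kap) => ? ? ?; lra.
Qed.

Lemma round_decrease p : p = prox alpha h (z - alpha *: avg v) ->
  favg f p + hr p - ps
    + alpha * (N%:R^-1 * \sum_(i < N) normsq (gf i p + (avg v - v i) - gavg gf p))
  <= (1 - alpha * mu / 4)
     * (favg f z + hr z - ps + alpha * (N%:R^-1 * \sum_(i < N) normsq (a i)))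
     + alpha * (25 / 4 * (N%:R^-1 * \sum_(i < N) normsq (n i))
                + 1 / 64 * (N%:R^-1 * \sum_(i < N) Q i) + Bh / 8).
Proof.
move=> pE; have := one_step pE erefl.
set V := N%:R^-1 * \sum_(i < N) normsq (gf i z - v i).
set E' := N%:R^-1 * \sum_(i < N) normsq (gf i p + _ - _).
set E := N%:R^-1 * \sum_(i < N) normsq (a i).
set Nn := N%:R^-1 * \sum_(i < N) normsq (n i).
set QQ := N%:R^-1 * \sum_(i < N) Q i.
have V_le : V <= 2 * Nn + 4 * kap * (QQ + 2 * E + 2 * normsq (gavg gf z)).
  have -> : 2 * Nn + 4 * kap * (QQ + 2 * E + 2 * normsq (gavg gf z))
    = N%:R^-1 * \sum_(i < N) (2 * normsq (n i)
        + 4 * kap * (Q i + 2 * normsq (a i) + 2 * normsq (gavg gf z))).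
    have avgE (u q w : 'I_N -> R) (m g : R) :
        N%:R^-1 * \sum_(i < N) (2 * u i + m * (q i + 2 * w i + 2 * g))
        = 2 * (N%:R^-1 * \sum_(i < N) u i) + m * (N%:R^-1 * (\sum_(i < N) q i)
          + 2 * (N%:R^-1 * \sum_(i < N) w i) + 2 * g).
      rewrite big_split/= -!mulr_sumr !big_split/= -!mulr_sumr sumr_const card_ord.
      by rewrite -[g *+ N]mulr_natl; field.
    by rewrite avgE.
  by rewrite ler_pM2l//; apply: ler_sum => i _; exact: client_error.
have gG := grad_bound z; have pl := PL z.
have avg0 (F : 'I_N -> R) : (forall i, 0 <= F i) -> 0 <= N%:R^-1 * \sum_(i < N) F i.
  by move=> F0; rewrite mulr_ge0 ?(ltW iN0)// sumr_ge0.
have E0 : 0 <= E by apply: avg0 => i; exact: normsq_ge0.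
have Nn0 : 0 <= Nn by apply: avg0 => i; exact: normsq_ge0.
have QQ0 : 0 <= QQ.
  apply: avg0 => i; rewrite /Q mulr_ge0 ?invr_ge0 ?ler0n// sumr_ge0// => k _.
  exact: normsq_ge0.
have G0 : 0 <= normsq (Gmap alpha h gf z) by exact: normsq_ge0.
have g0 : 0 <= normsq (gavg gf z) by exact: normsq_ge0.
(* Any subgradient witnesses this, and one exists at a proximal point. *)
have Bh0 : 0 <= Bh.
  have := subB (subgrad_prox hE h_lsc h_wc alpha0 ar1 obj_lb z).
  by apply: le_trans; exact: normsq_ge0.
move: V_le gG pl G0 g0 pE.
set G := normsq (Gmap _ _ _ _); set g2 := normsq (gavg _ _).
set Phi := favg f z + hr z - ps => V_le gG pl G0 g0 _ H.
have kQ : kap * QQ <= 1 / 1152 * QQ by rewrite ler_wpM2r.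
have kG : kap * G <= 1 / 1152 * G by rewrite ler_wpM2r.
have kB : kap * Bh <= 1 / 1152 * Bh by rewrite ler_wpM2r.
have kE : 24 * kap * E <= (1 - alpha * mu / 4) * E by rewrite ler_wpM2r.
have kg : kap * g2 <= kap * (2 * G + 2 * Bh) by rewrite ler_wpM2l.
(* In [3 * V] the coefficients are 6 for [Nn], [12 * kap <= 1/96] for [QQ], [24 * kap] for [E] (at
   most the contraction rate), and [24 * kap] for [g2], which yields at most [G / 24 + Bh / 24]. At
   least [G / 8] survives, and PL turns it into [mu / 4 * Phi]. *)
have key : - (G / 4) + 3 * V <= - (mu / 4 * Phi) + (1 - alpha * mu / 4) * E
   + (25 / 4 * Nn + 1 / 64 * QQ + Bh / 8).
  move: V_le kE kg pl; rewrite !(mulrDr (4 * kap)) mulrDr -!(mulrA 4) -!(mulrA 24).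
  rewrite !(mulrCA kap 2) -(mulrA 2 mu).
  set r := 1 - _; set kE := kap * E; set kq := kap * QQ; set kg2 := kap * g2.
  set kG' := kap * G; set kB' := kap * Bh; set rE := r * E.
  move: kQ kG kB; rewrite -/kq -/kG' -/kB' -mulrA.
  by rewrite (mulrAC mu); set mP := mu * Phi; lra.
have := ler_wpM2l (ltW alpha0) key.
by move: H; rewrite /Phi; set u := favg f p; set w := favg f z; lra.
Qed.

End Round.
End OneStep.
(** * Measurability of functions of random vectors *)

Section Measurability.
Context {R : realType} {d : nat} {dT : measure_display} {T : measurableType dT}.

Lemma measurable_fun_countable_select (C : countType) {dU : measure_display}
    {U : measurableType dU} (kap : T -> C) (g : C -> T -> U) :
  (forall c, measurable (kap @^-1` [set c])) ->
  (forall c, measurable_fun setT (g c)) ->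
  measurable_fun setT (fun w => g (kap w) w).
Proof.
move=> mkap mg _ A mA; rewrite setTI.
rewrite (_ : _ @^-1` A = \bigcup_c (kap @^-1` [set c] `&` (g c) @^-1` A)).
  apply: countable_bigcupT_measurable => [|c]; first exact: countableP.
  by apply: measurableI => //; rewrite -[X in measurable X]setTI; exact: mg.
apply/seteqP; split=> w /=; first by move=> Aw; exists (kap w).
by move=> [c _ [/= -> ]].
Qed.

(** Integer label of the cube of side [1/(n+1)] containing [x]; the labels are countably many, and
    [corner] recovers the lower vertex. *)
Definition cell (n : nat) (x : 'rV[R]_d) : 'rV[int]_d :=
  \row_j Num.floor (n.+1%:R * x 0 j).

Definition corner (n : nat) (c : 'rV[int]_d) : 'rV[R]_d :=
  \row_j ((c 0 j)%:~R / n.+1%:R).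

Lemma cell_corner_near n (x y : 'rV[R]_d) : cell n x = cell n y ->
  normsq (x - y) <= d%:R * n.+1%:R^-1 ^+ 2.
Proof.
move=> xy; rewrite -[d in d%:R]card_ord mulr_natl -sumr_const.
apply: ler_sum => j _; rewrite !mxE.
have n0 : 0 < n.+1%:R :> R by rewrite ltr0n.
have := congr1 (fun M : 'rV_d => M 0 j) xy; rewrite !mxE => fl.
have := floor_itv (n.+1%:R * x 0 j); have := floor_itv (n.+1%:R * y 0 j).
rewrite -fl intrD => /andP[y1 y2] /andP[x1 x2].
rewrite -(@ler_pM2l _ (n.+1%:R ^+ 2)) ?exprn_gt0// -!exprMn mulfV ?gt_eqF// expr1n.
rewrite mulrBr -(real_normK (num_real _)) expr_le1// ler_norml; lra.
Qed.

Lemma corner_cell n (x : 'rV[R]_d) : cell n (corner n (cell n x)) = cell n x.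
Proof.
apply/rowP => j; rewrite !mxE mulrC divfK ?pnatr_eq0// intrKfloor//.
Qed.

Lemma corner_cvg (x : 'rV[R]_d) : (corner n (cell n x)) @[n --> \oo] --> x.
Proof.
apply/cvgrPdist_lt => e e0.
(* [d.+1] dominates the square root of [d], the diameter factor of a cube, and is never 0. *)
have e1 : 0 < e / d.+1%:R by rewrite divr_gt0// ltr0n.
have := near_infty_natSinv_lt (PosNum e1); apply: filterS => n /= ne.
have H := cell_corner_near (esym (corner_cell n x)).
apply: (@le_lt_trans _ _ (d.+1%:R * n.+1%:R^-1)); last first.
  by rewrite mulrC -ltr_pdivlMr ?ltr0n.
apply: mx_norm_le_normsq; first by rewrite mulr_ge0 ?invr_ge0.
apply: (le_trans H); rewrite exprMn ler_wpM2r ?sqr_ge0//.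
by rewrite -natrX ler_nat (leq_trans (leqnSn d))// leq_pmulr.
Qed.

Lemma measurable_cell n (Y : T -> 'rV[R]_d) : vmeasurable Y ->
  forall c, measurable ((fun w => cell n (Y w)) @^-1` [set c]).
Proof.
move=> mY c.
rewrite (_ : _ @^-1` _ = \bigcap_(j in [set: 'I_d])
   ((fun w => n.+1%:R * Y w 0 j) @^-1` `[(c 0 j)%:~R, (c 0 j + 1)%:~R[%classic)).
  apply: fin_bigcap_measurable => [|j _]; first exact: finite_finset.
  rewrite -[X in measurable X]setTI.
  by apply: measurable_funM; [exact: measurable_cst|exact: mY| |exact: measurable_itv].
apply/seteqP; split=> w /=.
  by move=> <- j _ /=; rewrite in_itv/= mxE floor_itv.
move=> H; apply/rowP => j; rewrite mxE.
by have := H j I; rewrite /= in_itv/= => Hj; apply: floor_def.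
Qed.

(* F(Y, S) is the limit of F(Y_n, S), where Y_n rounds Y to the grid of mesh 1/(n+1)
   and thus takes countably many values. *)
Lemma measurable_fun_caratheodory {dX : measure_display} {X : measurableType dX}
    (F : 'rV[R]_d -> X -> R) (Y : T -> 'rV[R]_d) (S : T -> X) :
  (forall s, continuous (F^~ s)) -> (forall x, measurable_fun setT (F x)) ->
  vmeasurable Y -> measurable_fun setT S ->
  measurable_fun setT (fun w => F (Y w) (S w)).
Proof.
move=> cF mF mY mS.
apply: (@measurable_fun_cvg _ _ _ _ (fun n w => F (corner n (cell n (Y w))) (S w))).
  move=> n; apply: (@measurable_fun_countable_select _ _ _ (fun w => cell n (Y w))
     (fun c w => F (corner n c) (S w))); first exact: measurable_cell.
  by move=> c; apply: measurableT_comp.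
by move=> w _; exact: (cvg_comp _ _ (@corner_cvg (Y w)) (cF (S w) (Y w))).
Qed.

(** Measurability is given only coordinatewise, so the open set is exhausted by the countably many
    grid cells that it contains. *)
Lemma measurable_open_preimage (U : set 'rV[R]_d) (Y : T -> 'rV[R]_d) :
  open U -> vmeasurable Y -> measurable (Y @^-1` U).
Proof.
move=> oU mY.
pose Q n (c : 'rV[int]_d) := `[< forall y, cell n y = c -> U y >].
rewrite (_ : _ @^-1` U = \bigcup_n [set w | Q n (cell n (Y w))]).
  apply: bigcupT_measurable => n.
  have := @measurable_fun_countable_select _ _ _ (fun w => cell n (Y w))
     (fun c _ => Q n c) (@measurable_cell n _ mY) (fun c => measurable_cst _).
  move=> /(_ measurableT [set true] I); rewrite setTI; congr measurable.
apply/seteqP; split=> w /=; last first.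
  by move=> [n _ /= /asboolP]; exact.
move=> Uw; have /nbhs_ballP[e /= e0 eU] := open_nbhs_nbhs (conj oU Uw).
have e1 : 0 < e / d.+1%:R by rewrite divr_gt0// ltr0n.
have [n _ /(_ n (leqnn n)) /= ne] := near_infty_natSinv_lt (PosNum e1).
exists n => //; apply/asboolP => y yw; apply: eU.
rewrite -ball_normE /ball_/=.
apply: (@le_lt_trans _ _ (d.+1%:R * n.+1%:R^-1)); last first.
  by rewrite mulrC -ltr_pdivlMr ?ltr0n.
apply: mx_norm_le_normsq; first by rewrite mulr_ge0 ?invr_ge0.
apply: (le_trans (cell_corner_near (esym yw))).
by rewrite exprMn ler_wpM2r ?sqr_ge0// -natrX ler_nat (leq_trans (leqnSn d))// leq_pmulr.
Qed.

Lemma measurable_fun_continuous (g : 'rV[R]_d -> R) (Y : T -> 'rV[R]_d) :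
  continuous g -> vmeasurable Y -> measurable_fun setT (fun w => g (Y w)).
Proof.
move=> cg mY; apply: (@measurable_fun_caratheodory _ T (fun x _ => g x) Y id) => //.
Qed.

(** Lower semicontinuity says that the sets where [h] exceeds [a] are open, and the corresponding
    rays generate the Borel sets. *)
Lemma measurable_fun_lsc (h : 'rV[R]_d -> \bar R) (Y : T -> 'rV[R]_d) :
  Defs.lsc h -> vmeasurable Y -> measurable_fun setT (h \o Y).
Proof.
move=> lh mY; apply: (measurability _ (ErealGenOInfty.measurableE R)).
move=> /= _ [_ [a ->]] <-; rewrite setTI comp_preimage.
apply: measurable_open_preimage => //.
by rewrite preimage_itvoy openE => z /lh.
Qed.

Lemma vmeasurableD (Y Z : T -> 'rV[R]_d) : vmeasurable Y -> vmeasurable Z ->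
  vmeasurable (fun w => Y w + Z w).
Proof.
move=> mY mZ j; under eq_fun do rewrite mxE; exact: measurable_funD.
Qed.

Lemma vmeasurableZ (a : R) (Y : T -> 'rV[R]_d) : vmeasurable Y ->
  vmeasurable (fun w => a *: Y w).
Proof.
by move=> mY j; under eq_fun do rewrite mxE; apply: measurable_funM.
Qed.

Lemma vmeasurableB (Y Z : T -> 'rV[R]_d) : vmeasurable Y -> vmeasurable Z ->
  vmeasurable (fun w => Y w - Z w).
Proof.
move=> mY mZ j; under eq_fun do rewrite !mxE; exact: measurable_funB.
Qed.

Lemma vmeasurable_cst (c : 'rV[R]_d) : vmeasurable (fun _ : T => c).
Proof. by move=> j; exact: measurable_cst. Qed.

Lemma vmeasurable_sum n (Y : 'I_n -> T -> 'rV[R]_d) : (forall i, vmeasurable (Y i)) ->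
  vmeasurable (fun w => \sum_(i < n) Y i w).
Proof.
move=> mY j; under eq_fun do rewrite summxE.
by apply: measurable_sum => i; exact: mY.
Qed.

Lemma measurable_normsq (Y : T -> 'rV[R]_d) : vmeasurable Y ->
  measurable_fun setT (fun w => normsq (Y w)).
Proof.
move=> mY; apply: measurable_sum => j.
by apply: measurable_funX; exact: mY.
Qed.

Lemma lipschitz_continuous (g : 'rV[R]_d -> 'rV[R]_d) (M : R) :
  (forall x y, normsq (g x - g y) <= M ^+ 2 * normsq (x - y)) ->
  forall j, continuous (fun x => g x 0 j).
Proof.
move=> gM j x; apply/(@cvgrPdist_lt _ _ _ (nbhs x)) => e e0.
have M0 : 0 < `|M| + 1 by rewrite ltr_pwDr.
have : 0 < (e / (`|M| + 1)) ^+ 2 by rewrite exprn_gt0// divr_gt0.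
move=> /(near_normsq x); apply: filterS => y xy.
rewrite distrC -(@ltr_pXn2r _ 2) ?nnegrE ?(ltW e0)// real_normK ?num_real//.
apply: (@le_lt_trans _ _ (normsq (g y - g x))).
  rewrite /normsq (bigD1 j)//= !mxE lerDl sumr_ge0// => k _; exact: sqr_ge0.
apply: (le_lt_trans (gM _ _)).
apply: (@le_lt_trans _ _ ((`|M| + 1) ^+ 2 * normsq (y - x))).
  rewrite ler_wpM2r ?normsq_ge0// -(real_normK (num_real M)) lerXn2r ?nnegrE ?addr_ge0//.
  by rewrite lerDl.
by rewrite mulrC -ltr_pdivlMr ?exprn_gt0// -exprVn -exprMn.
Qed.

Lemma vmeasurable_lipschitz (g : 'rV[R]_d -> 'rV[R]_d) (M : R) (Y : T -> 'rV[R]_d) :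
  (forall x y, normsq (g x - g y) <= M ^+ 2 * normsq (x - y)) ->
  vmeasurable Y -> vmeasurable (fun w => g (Y w)).
Proof.
move=> gM mY j; apply: (@measurable_fun_continuous (fun x => g x 0 j)) => //.
exact: lipschitz_continuous gM j.
Qed.

(** Coordinate [j] is the limit of difference quotients with steps [1/(n+1)]; each is jointly
    measurable because [F] is differentiable, hence continuous, in its first argument. *)
Lemma vmeasurable_gradient {dX : measure_display} {X : measurableType dX}
    (F : 'rV[R]_d -> X -> R) (G : 'rV[R]_d -> X -> 'rV[R]_d)
    (Y : T -> 'rV[R]_d) (S : T -> X) :
  (forall s x, has_gradient (F^~ s) x (G x s)) ->
  (forall x, measurable_fun setT (F x)) ->
  vmeasurable Y -> measurable_fun setT S -> vmeasurable (fun w => G (Y w) (S w)).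
Proof.
move=> gF mF mY mS j.
have mF' (Z : T -> 'rV[R]_d) : vmeasurable Z -> measurable_fun setT (fun w => F (Z w) (S w)).
  move=> mZ; apply: measurable_fun_caratheodory => // s x.
  by apply: differentiable_continuous; exact: (gF s x).1.
pose u := delta_mx 0 j : 'rV[R]_d.
apply: (@measurable_fun_cvg _ _ _ _
  (fun n w => n.+1%:R * (F (n.+1%:R^-1 *: u + Y w) (S w) - F (Y w) (S w)))).
  move=> n; apply: measurable_funM; first exact: measurable_cst.
  apply: measurable_funB; apply: mF' => //.
  by apply: vmeasurableD => //; exact: vmeasurable_cst.
move=> w _; have [dF eF] := gF (S w) (Y w).
have <- : 'D_u (F^~ (S w)) (Y w) = G (Y w) (S w) 0 j.
  rewrite deriveE// eF /dotv (bigD1 j)//= big1 ?addr0 => [|i ij].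
    by rewrite /u mxE !eqxx mulr1.
  by rewrite /u mxE (negbTE ij) andbF mulr0.
have H : h^-1 *: (((F^~ (S w)) \o shift (Y w)) (h *: u) - F (Y w) (S w)) @[h --> 0^']
  --> 'D_u (F^~ (S w)) (Y w) by exact: diff_derivable.
have nz n : n.+1%:R^-1 != 0 :> R by rewrite invr_eq0 pnatr_eq0.
have := (cvgr_dnbhsP _ _ _).1 H _ (conj nz (@cvg_harmonic R)).
apply: cvg_trans; apply: near_eq_cvg; near=> n.
by rewrite /= invrK.
Unshelve. all: by end_near. Qed.

End Measurability.
(** * Independence of past and fresh samples *)

Section IndependentTonelli.
Context {R : realType} {d1 dA dB : measure_display} {Omega : measurableType d1}.
Context {A : measurableType dA} {B : measurableType dB}.
Variables (P : probability Omega R) (a : Omega -> A) (b : Omega -> B).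
Hypotheses (ma : measurable_fun setT a) (mb : measurable_fun setT b).
Hypothesis indep : forall S S', measurable S -> measurable S' ->
  (P (a @^-1` S `&` b @^-1` S') = P (a @^-1` S) * P (b @^-1` S'))%E.

(** Independence on rectangles makes the joint law a product, so Tonelli integrates out [b] with [a]
    frozen. This replaces a bound on a conditional expectation. *)
Lemma independent_integral_le (psi : A * B -> \bar R) (g : Omega -> \bar R) :
  measurable_fun setT psi -> (forall p, 0 <= psi p)%E ->
  measurable_fun setT g -> (forall w, \int[P]_w' psi (a w, b w') <= g w)%E ->
  (\int[P]_w psi (a w, b w) <= \int[P]_w g w)%E.
Proof.
move=> mpsi psi0 mg psig.
pose fa : {mfun Omega >-> A} := HB.pack a (isMeasurableFun.Build _ _ _ _ a ma).
pose fb : {mfun Omega >-> B} := HB.pack b (isMeasurableFun.Build _ _ _ _ b mb).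
pose ab w := (a w, b w).
have mab : measurable_fun setT ab by exact: measurable_fun_pair.
pose fab : {mfun Omega >-> (A * B)%type} := HB.pack ab (isMeasurableFun.Build _ _ _ _ ab mab).
rewrite -[leLHS](@ge0_integral_distribution _ _ _ _ _ P fab psi)//.
rewrite (@eq_measure_integral _ _ _ _ (distribution P fa \x distribution P fb)%E); last first.
  move=> S mS _; apply/esym; exact: product_measure_unique.
have mF : measurable_fun setT (fubini_F (distribution P fb) psi).
  exact: measurable_fun_fubini_tonelli_F.
have F0 x : (0 <= fubini_F (distribution P fb) psi x)%E by apply: integral_ge0.
rewrite fubini_tonelli1// ge0_integral_distribution//.
apply: ge0_le_integral => //.
- by move=> w _; exact: F0.
- exact: (measurableT_comp mF ma).
move=> w _ /=; apply: le_trans (psig w); rewrite /fubini_F.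
rewrite ge0_integral_distribution//.
by apply: measurableT_comp => //; exact: measurable_pair1.
Qed.

End IndependentTonelli.

(** * Independence of sigma-algebras generated by disjoint sample families *)

Section Cylinders.
Context {R : realType} {d1 : measure_display} {Omega : measurableType d1}.
Variable P : probability Omega R.
Context {I : eqType} {d0 : measure_display} {X : measurableType d0}.
Variable Y : I -> Omega -> X.
Hypothesis mY : forall i, measurable_fun setT (Y i).
Hypothesis iY : mutually_independent P Y.

Definition cylinder (s : seq I) (A : I -> set X) : set Omega :=
  \bigcap_(i in [set` s]) (Y i @^-1` A i).

(** The pi-system of finite-dimensional events that generates the sigma-algebra of the [Y i] with
    [i] in [Q]. *)
Definition cylinders (Q : {pred I}) : set (set Omega) :=
  [set C | exists s A, [/\ {subset s <= Q}, (forall i, measurable (A i))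
                         & C = cylinder s A]].

Lemma cylinder_cat (s s' : seq I) A :
  cylinder (s ++ s') A = cylinder s A `&` cylinder s' A.
Proof.
apply/seteqP; split=> w /=.
  by move=> H; split=> i si; apply: H; rewrite /= mem_cat; apply/orP; [left|right].
by move=> [H H'] i; rewrite /= mem_cat => /orP[]; [exact: H|exact: H'].
Qed.

Lemma eq_cylinder (s : seq I) A A' : {in s, A =1 A'} -> cylinder s A = cylinder s A'.
Proof.
by move=> AA'; apply/eq_bigcapr => i si; rewrite AA'.
Qed.

Lemma cylinders_setI Q : setI_closed (cylinders Q).
Proof.
move=> _ _ [s [A [sQ mA ->]]] [s' [A' [sQ' mA' ->]]].
pose A1 i := if i \in s then A i else setT.
pose A2 i := if i \in s' then A' i else setT.
exists (s ++ s'), (fun i => A1 i `&` A2 i); split.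
- by move=> i; rewrite mem_cat => /orP[/sQ|/sQ'].
- by move=> i; apply: measurableI; rewrite /A1 /A2; case: ifP.
- apply/seteqP; split=> w /=.
    move=> [H H'] i; rewrite /= mem_cat /A1 /A2 => _.
    by split; case: ifP => // si; [exact: H|exact: H'].
  move=> H; split=> i si; have := H i; rewrite /= mem_cat si ?orbT => /(_ isT)[].
    by rewrite /A1 si.
  by rewrite /A2 si.
Qed.

Lemma measurable_cylinder (s : seq I) A : (forall i, measurable (A i)) ->
  measurable (cylinder s A).
Proof.
move=> mA; apply: fin_bigcap_measurable => [|i _]; first exact: finite_seq.
by rewrite -[X in measurable X]setTI; exact: mY.
Qed.

Lemma cylinders_measurable Q : cylinders Q `<=` measurable.
Proof. by move=> _ [s [A [_ mA ->]]]; exact: measurable_cylinder. Qed.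

Lemma cylinders_setT Q : cylinders Q setT.
Proof.
exists [::], (fun=> setT); split=> //.
by apply/seteqP; split=> w // _ i.
Qed.

Lemma cylinders_preimage (Q : {pred I}) i A : i \in Q -> measurable A ->
  cylinders Q (Y i @^-1` A).
Proof.
move=> iQ mA; exists [:: i], (fun=> A); split=> //.
  by move=> j; rewrite inE => /eqP ->.
apply/seteqP; split=> w /=; first by move=> H j; rewrite /= inE => /eqP ->.
by apply; rewrite /= inE.
Qed.

Lemma cylinder_prob (s : seq I) A : uniq s -> (forall i, measurable (A i)) ->
  P (cylinder s A) = (\prod_(i <- s) P (Y i @^-1` A i))%E.
Proof. by move=> us mA; exact: iY. Qed.

(** Disjointness lets both families of sets merge into one, so the intersection is a single
    cylinder. Duplicates are removed because mutual independence concerns lists without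
    repetition. *)
Lemma cylinders_indep (Q Q' : {pred I}) C C' : [predI Q & Q'] =i pred0 ->
  cylinders Q C -> cylinders Q' C' -> P (C `&` C') = (P C * P C')%E.
Proof.
move=> QQ' [s [A [sQ mA ->]]] [s' [A' [sQ' mA' ->]]].
have undupE (t : seq I) B : cylinder t B = cylinder (undup t) B.
  by apply/seteqP; split=> w H i /=; have := H i; rewrite /= mem_undup.
rewrite (undupE s) (undupE s').
have disj i : i \in s -> i \in s' -> False.
  by move=> /sQ iQ /sQ' iQ'; have := QQ' i; rewrite !inE iQ iQ'.
pose A2 i := if i \in s then A i else A' i.
have e1 : cylinder (undup s) A = cylinder (undup s) A2.
  by apply: eq_cylinder => i; rewrite mem_undup /A2 => ->.
have e2 : cylinder (undup s') A' = cylinder (undup s') A2.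
  apply: eq_cylinder => i; rewrite mem_undup /A2 => is'.
  by case: ifP => // /disj/(_ is').
have mA2 i : measurable (A2 i) by rewrite /A2; case: ifP.
rewrite e1 e2 -cylinder_cat !cylinder_prob ?undup_uniq// ?big_cat//.
rewrite cat_uniq !undup_uniq/= andbT; apply/hasPn => i.
by rewrite !mem_undup => is'; apply/negP => /disj/(_ is').
Qed.

Lemma sigma_cylinders_measurable Q : <<s cylinders Q >> `<=` measurable.
Proof.
by apply: smallest_sub; [exact: sigma_algebra_measurable|exact: cylinders_measurable].
Qed.

(** For fixed [C] both sides are finite measures in [D] that agree on a pi-system, so uniqueness of
    measures extends the equality. Applied once for each argument, it yields independence of the two
    sigma-algebras. *)
Lemma sigma_indep_step (G : set (set Omega)) C :
  measurable C -> setI_closed G -> G setT -> G `<=` measurable ->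
  (forall D, G D -> P (C `&` D) = (P C * P D)%E) ->
  forall D, <<s G >> D -> P (C `&` D) = (P C * P D)%E.
Proof.
move=> mC GI GT Gm H D GD.
have PCf : P C \is a fin_num by exact: fin_num_measure.
have r0 : 0 <= fine (P C) by exact: fine_ge0.
pose m1 := mrestr P mC.
pose m2 := mscale (NngNum r0) P.
rewrite setIC -[LHS]/(m1 D) -[P C]fineK//.
apply: (@g_sigma_algebra_measure_unique _ _ _ G Gm (fun=> setT) (fun=> GT) _ m1 m2) => //.
- exact: bigcup_const.
- move=> A GA; change (P (A `&` C) = (fine (P C))%:E * P A)%E.
  by rewrite fineK// -H// setIC.
- by move=> _; change (P (setT `&` C) < +oo)%E; rewrite setTI -(fineK PCf) ltry.
Qed.

Lemma sigma_cylinders_indep (Q Q' : {pred I}) C C' : [predI Q & Q'] =i pred0 ->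
  <<s cylinders Q >> C -> <<s cylinders Q' >> C' -> P (C `&` C') = (P C * P C')%E.
Proof.
move=> QQ' sC sC'.
apply: (sigma_indep_step (sigma_cylinders_measurable sC) (@cylinders_setI Q')
  (cylinders_setT Q') (@cylinders_measurable Q')) => // D cD.
rewrite setIC muleC.
apply: (sigma_indep_step (cylinders_measurable cD) (@cylinders_setI Q)
  (cylinders_setT Q) (@cylinders_measurable Q)) => // E cE.
by rewrite setIC muleC; exact: cylinders_indep.
Qed.

(** The points of Omega with a coarser sigma-algebra: measurability here means dependence on the
    samples in [Q] only. *)
Definition cylType (Q : {pred I}) := g_sigma_algebraType (cylinders Q).

Lemma measurable_cylType (Q : {pred I}) i : i \in Q ->
  measurable_fun setT (Y i : cylType Q -> X).
Proof.
move=> iQ _ A mA; rewrite setTI; apply: sub_sigma_algebra.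
exact: cylinders_preimage.
Qed.

Lemma measurable_cyl_id (Q : {pred I}) :
  measurable_fun setT (id : Omega -> cylType Q).
Proof. by move=> _ A mA; rewrite setTI; exact: (@sigma_cylinders_measurable Q). Qed.

(** Both random elements are the identity of Omega, read in two coarser sigma-algebras that are
    independent. *)
Lemma cylinders_integral_le (Q Q' : {pred I})
    (psi : cylType Q * cylType Q' -> \bar R) (g : Omega -> \bar R) :
  [predI Q & Q'] =i pred0 ->
  measurable_fun setT psi -> (forall p, 0 <= psi p)%E ->
  measurable_fun setT g -> (forall w, \int[P]_w' psi (w, w') <= g w)%E ->
  (\int[P]_w psi (w, w) <= \int[P]_w g w)%E.
Proof.
move=> QQ'.
apply: (@independent_integral_le _ _ _ _ _ (cylType Q) (cylType Q') P id id
  (@measurable_cyl_id Q) (@measurable_cyl_id Q')).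
by move=> S S' mS mS'; exact: (sigma_cylinders_indep QQ').
Qed.

End Cylinders.
(** * Stochastic gradient noise *)

Section AlgorithmMeasurability.
Context {R : realType} {d N K B : nat}.
Context {d0 : measure_display} {X : measurableType d0}.
Variables (F : 'I_N -> 'rV[R]_d -> X -> R) (gF : 'I_N -> 'rV[R]_d -> X -> 'rV[R]_d).
Variables (h : 'rV[R]_d -> \bar R) (alpha beta Lp : R).
Hypothesis gFP : forall i s x, has_gradient (fun y => F i y s) x (gF i x s).
Hypothesis mF : forall i x, measurable_fun setT (F i x).
Hypothesis proxL : forall y y',
  normsq (prox alpha h y - prox alpha h y') <= Lp ^+ 2 * normsq (y - y').

Section OneSpace.
Context {dT : measure_display} {T : measurableType dT}.
Variables (xi : nat -> 'I_N -> nat -> 'I_B -> T -> X).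

Lemma vmeasurable_gbatch i (Y : T -> 'rV[R]_d) (S : 'I_B -> T -> X) :
  vmeasurable Y -> (forall b, measurable_fun setT (S b)) ->
  vmeasurable (fun w => gbatch gF i (Y w) (fun b => S b w)).
Proof.
move=> mY mS; apply: vmeasurableZ; apply: vmeasurable_sum => b.
by apply: (vmeasurable_gradient (gFP i)) => //; exact: mF.
Qed.

Lemma vmeasurable_xloc t i (z c : T -> 'rV[R]_d) k :
  (forall j b, (j < k)%N -> measurable_fun setT (xi t i j b)) ->
  vmeasurable z -> vmeasurable c ->
  vmeasurable (fun w => xloc beta gF xi t i (z w) (c w) w k).
Proof.
move=> mxi mz mc; elim: k mxi => [//|k IH] mxi /=.
have {}IH : vmeasurable (fun w => xloc beta gF xi t i (z w) (c w) w k).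
  by apply: IH => j b jk; apply: mxi; rewrite ltnS ltnW.
apply: vmeasurableB => //; apply: vmeasurableZ; apply: vmeasurableD => //.
by apply: vmeasurable_gbatch => // b; apply: mxi.
Qed.

Lemma vmeasurable_Delta t i (z c : T -> 'rV[R]_d) :
  (forall j b, measurable_fun setT (xi t i j b)) ->
  vmeasurable z -> vmeasurable c ->
  vmeasurable (fun w => Delta K beta gF xi t i (z w) (c w) w).
Proof.
move=> mxi mz mc; apply: vmeasurableZ; apply: vmeasurableB => //.
by apply: vmeasurable_xloc.
Qed.

(** The space is arbitrary and only samples of earlier rounds are constrained, so the lemma serves
    both for Omega and for the sigma-algebra of the past. *)
Lemma vmeasurable_fstate z0 c0 t :
  (forall t' i k b, (t' < t)%N -> measurable_fun setT (xi t' i k b)) ->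
  vmeasurable (zit K alpha beta h gF xi z0 c0 t) /\
  forall i, vmeasurable (fun w => cit K alpha beta h gF xi z0 c0 t w i).
Proof.
elim: t => [|t IH] mxi; first by split=> [|i]; exact: vmeasurable_cst.
have {IH}[mz mc] : vmeasurable (zit K alpha beta h gF xi z0 c0 t) /\
  forall i, vmeasurable (fun w => cit K alpha beta h gF xi z0 c0 t w i).
  by apply: IH => t' i k b tt'; apply: mxi; rewrite ltnS ltnW.
have mD i : vmeasurable (fun w => Delta K beta gF xi t i
    (zit K alpha beta h gF xi z0 c0 t w) (cit K alpha beta h gF xi z0 c0 t w i) w).
  by apply: vmeasurable_Delta => // j b; exact: mxi.
have mDb : vmeasurable (fun w => Deltabar K beta gF xi t
    (zit K alpha beta h gF xi z0 c0 t w) (cit K alpha beta h gF xi z0 c0 t w) w).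
  by apply: vmeasurableZ; exact: vmeasurable_sum.
split=> [|i].
  apply: (vmeasurable_lipschitz proxL); apply: vmeasurableB => //.
  exact: vmeasurableZ.
exact: (vmeasurableB (vmeasurableD (mc i) mDb) (mD i)).
Qed.

End OneSpace.

(** * Orthogonality of the gradient noise *)

Section Noise.
Context {d1 : measure_display} {Omega : measurableType d1}.
Variables (P : probability Omega R) (xi : nat -> 'I_N -> nat -> 'I_B -> Omega -> X).
Variables (gf : 'I_N -> 'rV[R]_d -> 'rV[R]_d) (z0 : 'rV[R]_d) (c0 : 'I_N -> 'rV[R]_d).
Variables (L s2 : R).
Hypothesis gfL : forall i x y, normsq (gf i x - gf i y) <= L ^+ 2 * normsq (x - y).
Hypothesis mxi : forall t i k b, measurable_fun setT (xi t i k b).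
Hypothesis xi_indep : mutually_independent P
  (fun p : nat * 'I_N * nat * 'I_B => xi p.1.1.1 p.1.1.2 p.1.2 p.2).
Hypothesis unbiased : forall t i k x (j : 'I_d),
  P.-integrable setT (fun w => (gbatch gF i x (fun b => xi t i k b w) 0 j)%:E) /\
  (\int[P]_w (gbatch gF i x (fun b => xi t i k b w) 0 j)%:E = (gf i x 0 j)%:E)%E.
Hypothesis variance : forall t i k x,
  (\int[P]_w (normsq (gbatch gF i x (fun b => xi t i k b w) - gf i x))%:E <= s2%:E)%E.

Lemma variance_ge0 : (0 < N)%N -> 0 <= s2.
Proof.
move=> N0; rewrite -lee_fin; apply: le_trans (variance 0%N (Ordinal N0) 0%N 0).
by apply: integral_ge0 => w _; rewrite lee_fin normsq_ge0.
Qed.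

Definition zt t w := zit K alpha beta h gF xi z0 c0 t w.
Definition ct t w i := cit K alpha beta h gF xi z0 c0 t w i.
Definition xt t i k w := xloc beta gF xi t i (zt t w) (ct t w i) w k.
Definition noise t i k w :=
  gbatch gF i (xt t i k w) (fun b => xi t i k b w) - gf i (xt t i k w).

(* Samples are indexed by (round, client, local step, batch position). *)
Definition past t i k : {pred nat * 'I_N * nat * 'I_B} :=
  [pred p | (p.1.1.1 < t)%N || [&& p.1.1.1 == t, p.1.1.2 == i & (p.1.2 < k)%N]].
Definition fresh t i k : {pred nat * 'I_N * nat * 'I_B} :=
  [pred p | [&& p.1.1.1 == t, p.1.1.2 == i & p.1.2 == k]].

Lemma past_fresh t i k : [predI past t i k & fresh t i k] =i pred0.
Proof.
move=> p; rewrite !inE; apply/negbTE/negP => /andP[pp /and3P[/eqP tE /eqP iE /eqP kE]].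
by move: pp; rewrite tE iE kE !ltnn !andbF.
Qed.

Let Xi (p : nat * 'I_N * nat * 'I_B) := xi p.1.1.1 p.1.1.2 p.1.2 p.2.

Lemma vmeasurable_mean {dT : measure_display} {T : measurableType dT} i (Y : T -> 'rV[R]_d) :
  vmeasurable Y -> vmeasurable (fun w => gf i (Y w)).
Proof. exact: (vmeasurable_lipschitz (gfL i)). Qed.

Lemma past_measurable t i k (Q : {pred _}) : {subset past t i k <= Q} ->
  vmeasurable (xt t i k : cylType Xi Q -> 'rV[R]_d).
Proof.
move=> pQ.
have mX p : p \in past t i k -> measurable_fun setT (Xi p : cylType Xi Q -> X).
  by move=> /pQ; exact: measurable_cylType.
have [mz mc] := @vmeasurable_fstate _ (cylType Xi Q) xi z0 c0 t
  (fun t' i' k' b tt' => mX (t', i', k', b) (introT orP (or_introl tt'))).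
have mx j b : (j < k)%N -> measurable_fun setT (xi t i j b : cylType Xi Q -> X).
  by move=> jk; apply: (mX (t, i, j, b)); rewrite !inE !eqxx jk orbT.
exact: (@vmeasurable_xloc _ (cylType Xi Q) xi t i _ _ k mx mz (mc i)).
Qed.

Lemma noise_past_measurable t i j k : (j < k)%N ->
  vmeasurable (noise t i j : cylType Xi (past t i k) -> 'rV[R]_d).
Proof.
move=> jk.
have mx : vmeasurable (xt t i j : cylType Xi (past t i k) -> 'rV[R]_d).
  apply: past_measurable => p; rewrite !inE => /orP[->//|/and3P[-> -> pj]].
  by rewrite (ltn_trans pj jk) orbT.
apply: vmeasurableB; last exact: vmeasurable_mean.
apply: (@vmeasurable_gbatch _ (cylType Xi (past t i k)) i _ (xi t i j)) => // b.
apply: (@measurable_cylType _ _ _ _ _ Xi (past t i k) (t, i, j, b)).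
by rewrite !inE !eqxx jk orbT.
Qed.

(** With the query point frozen, the cross term is a linear combination of coordinates of mean
    zero. *)
Lemma integral_shifted_noise t i k x (a : 'rV[R]_d) :
  (\int[P]_w (normsq (a + (gbatch gF i x (fun b => xi t i k b w) - gf i x)))%:E
   <= (normsq a + s2)%:E)%E.
Proof.
pose u w := gbatch gF i x (fun b => xi t i k b w) - gf i x.
have mu : vmeasurable u.
  apply: vmeasurableB; last exact: vmeasurable_cst.
  by apply: vmeasurable_gbatch => //; exact: vmeasurable_cst.
have iu j : P.-integrable setT (fun w => (u w 0 j)%:E).
  have [ig _] := unbiased t i k x j.
  rewrite (_ : (fun w => _) = (fun w => (gbatch gF i x (fun b => xi t i k b w) 0 j)%:E
    - cst (gf i x 0 j)%:E w)%E); last by apply/funext => w; rewrite !mxE EFinB.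
  apply: integrableB => //; exact: finite_measure_integrable_cst.
have u0 j : (\int[P]_w (u w 0 j)%:E = 0)%E.
  have [ig eg] := unbiased t i k x j.
  have uE w : u w 0 j = gbatch gF i x (fun b => xi t i k b w) 0 j - gf i x 0 j.
    by rewrite /u mxE [in X in _ + X]mxE.
  under eq_integral do rewrite uE EFinB.
  rewrite integralB//; last exact: finite_measure_integrable_cst.
  by rewrite eg integral_cst//= probability_setT mule1 subee.
have ia j : P.-integrable setT (fun w => ((a 0 j)%:E * (u w 0 j)%:E)%E).
  exact: integrableZl.
have idot : P.-integrable setT (fun w => (2 * dotv a (u w))%:E).
  rewrite (_ : (fun w => _) = (fun w => 2%:E * \sum_(j < d) (a 0 j)%:E * (u w 0 j)%:E)%E).
    by apply: integrableZl => //; apply: integrable_sum => // j _; exact: ia.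
  by apply/funext => w; rewrite EFinM /dotv -sumEFin.
have dot0 : (\int[P]_w (2 * dotv a (u w))%:E = 0)%E.
  under eq_integral do rewrite EFinM /dotv -sumEFin.
  rewrite integralZl//; last first.
    by apply: integrable_sum => // j _; exact: ia.
  rewrite integral_sum//.
  rewrite big1 ?mule0// => j _.
  by under eq_integral do rewrite EFinM; rewrite integralZl// u0 mule0.
have mn : measurable_fun setT (fun w => (normsq (u w))%:E).
  by apply/measurable_EFinP; exact: measurable_normsq.
have isq : P.-integrable setT (fun w => (normsq (u w))%:E).
  apply/integrableP; split=> //.
  under eq_integral do rewrite gee0_abs ?lee_fin ?normsq_ge0//.
  exact: le_lt_trans (variance t i k x) (ltry _).
under eq_integral do rewrite normsqD 2!EFinD.
rewrite integralD//; last first.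
  by apply: integrableD => //; exact: finite_measure_integrable_cst.
rewrite integralD//; last exact: finite_measure_integrable_cst.
rewrite dot0 adde0 integral_cst//= probability_setT mule1 EFinD.
by rewrite leeD2l// variance.
Qed.

(* Conditionally on the past, the cross term 2 <A, noise> of the square has mean zero. *)
Lemma noise_step t i k (A : Omega -> 'rV[R]_d) :
  vmeasurable (A : cylType Xi (past t i k) -> 'rV[R]_d) ->
  (\int[P]_w (normsq (A w + noise t i k w))%:E
   <= \int[P]_w (normsq (A w))%:E + s2%:E)%E.
Proof.
move=> mA; set Q := past t i k in mA *; pose Q' := fresh t i k.
have mXi p : measurable_fun setT (Xi p) by exact: mxi.
(* The sample path is doubled: [p.1] supplies the past and [p.2] the fresh batch. On the diagonal
   this is the original integrand. *)
pose psi (p : cylType Xi Q * cylType Xi Q') := (normsq (A p.1 +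
  (gbatch gF i (xt t i k p.1) (fun b => xi t i k b p.2) - gf i (xt t i k p.1))))%:E.
have mA' : vmeasurable A.
  by move=> j; apply: (measurableT_comp (mA j)); exact: (measurable_cyl_id mXi).
have mx : vmeasurable ((xt t i k \o fst) : cylType Xi Q * cylType Xi Q' -> 'rV[R]_d).
  have mx0 : vmeasurable (xt t i k : cylType Xi Q -> 'rV[R]_d) by apply: past_measurable.
  by move=> j; exact: (measurableT_comp (mx0 j) measurable_fst).
have mpsi : measurable_fun setT psi.
  apply/measurable_EFinP; apply: measurable_normsq; apply: vmeasurableD.
    by move=> j; exact: (measurableT_comp (mA j) measurable_fst).
  apply: vmeasurableB; last exact: vmeasurable_mean.
  have mS b : measurable_fun setT ((xi t i k b : cylType Xi Q' -> X) \o snd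
      : cylType Xi Q * cylType Xi Q' -> X).
    apply: (measurableT_comp _ measurable_snd).
    by apply: (@measurable_cylType _ _ _ _ _ Xi Q' (t, i, k, b)); rewrite !inE !eqxx.
  exact: (vmeasurable_gbatch i mx mS).
have s20 : 0 <= s2 by apply: variance_ge0; exact: (leq_ltn_trans _ (ltn_ord i)).
have s2E : (s2%:E = \int[P]_w (cst s2%:E w))%E.
  by rewrite integral_cst//= probability_setT mule1.
have mn : measurable_fun setT (fun w => (normsq (A w))%:E).
  by apply/measurable_EFinP; exact: measurable_normsq.
have n0 w : [set: Omega] w -> (0 <= (normsq (A w))%:E)%E by rewrite lee_fin normsq_ge0.
have c0' w : [set: Omega] w -> (0 <= cst s2%:E w)%E by rewrite lee_fin.
rewrite s2E -(ge0_integralD P measurableT n0 mn c0' (measurable_cst _)).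
have psi0 p : (0 <= psi p)%E by rewrite lee_fin normsq_ge0.
have mg : measurable_fun setT (fun w => (normsq (A w))%:E + cst s2%:E w)%E.
  by apply: emeasurable_funD; [exact: mn|exact: measurable_cst].
have := @cylinders_integral_le _ _ _ P _ _ _ Xi mXi xi_indep Q Q' psi _
  (@past_fresh t i k) mpsi psi0 mg.
apply=> w; rewrite /psi /= -EFinD.
exact: (@integral_shifted_noise t i k (xt t i k w) (A w)).
Qed.

Lemma noise_measurable t i k : vmeasurable (noise t i k).
Proof.
have mXi p : measurable_fun setT (Xi p) by exact: mxi.
move=> j; apply: (measurableT_comp (noise_past_measurable (ltnSn k) j)).
exact: (measurable_cyl_id mXi).
Qed.

(** Adding one noise term to the partial sum of the earlier ones costs only [s2]; linear growth in
    [k] is what gains the factor [1/K] after averaging. *)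
Lemma noise_sum t i k :
  (\int[P]_w (normsq (\sum_(j < k) noise t i j w))%:E <= (k%:R * s2)%:E)%E.
Proof.
elim: k => [|k IH].
  by under eq_integral do rewrite big_ord0 normsq0; rewrite integral0 mul0r.
under eq_integral do rewrite big_ord_recr/=.
apply: le_trans; first apply: noise_step.
  by apply: vmeasurable_sum => j; exact: noise_past_measurable.
by rewrite -natr1 mulrDl mul1r EFinD leeD2r.
Qed.

Lemma noise_second_moment t i k : (\int[P]_w (normsq (noise t i k w))%:E <= s2%:E)%E.
Proof.
have := @noise_step t i k (fun=> 0) (@vmeasurable_cst _ _ _ _ 0).
under eq_integral do rewrite add0r.
by under [X in (_ <= X + _)%E -> _]eq_integral do rewrite normsq0; rewrite integral0 add0e.
Qed.

End Noise.
End AlgorithmMeasurability.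

(** * Convergence rate *)

Section NonnegativeIntegrals.
Context {R : realType} {d1 : measure_display} {Omega : measurableType d1}.
Variable P : probability Omega R.

(** Nonnegativity makes measurability enough for linearity, so integrability is never tracked. *)
Lemma integral_lin_le (A B : Omega -> R) (a b CA CB : R) :
  0 <= a -> 0 <= b -> (forall w, 0 <= A w) -> (forall w, 0 <= B w) ->
  measurable_fun setT A -> measurable_fun setT B ->
  (\int[P]_w (A w)%:E <= CA%:E)%E -> (\int[P]_w (B w)%:E <= CB%:E)%E ->
  (\int[P]_w (a * A w + b * B w)%:E <= (a * CA + b * CB)%:E)%E.
Proof.
move=> a0 b0 A0 B0 mA mB hA hB.
have mAE : measurable_fun setT (EFin \o A) by exact/measurable_EFinP.
have mBE : measurable_fun setT (EFin \o B) by exact/measurable_EFinP.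
under eq_integral do rewrite EFinD !EFinM.
rewrite ge0_integralD//; first last.
- by apply: emeasurable_funM => //; exact: measurable_cst.
- by move=> w _; rewrite -EFinM lee_fin mulr_ge0.
- by apply: emeasurable_funM => //; exact: measurable_cst.
- by move=> w _; rewrite -EFinM lee_fin mulr_ge0.
rewrite !ge0_integralZl//; try by move=> w _; rewrite lee_fin.
by rewrite EFinD !EFinM; apply: leeD; apply: lee_wpmul2l; rewrite ?lee_fin.
Qed.

Lemma integral_scale_le (A : Omega -> R) (a C : R) :
  0 <= a -> (forall w, 0 <= A w) -> measurable_fun setT A ->
  (\int[P]_w (A w)%:E <= C%:E)%E -> (\int[P]_w (a * A w)%:E <= (a * C)%:E)%E.
Proof.
move=> a0 A0 mA AC; under eq_integral do rewrite EFinM.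
rewrite ge0_integralZl//; last by move=> w _; rewrite lee_fin.
  by rewrite EFinM; apply: lee_wpmul2l; rewrite ?lee_fin.
exact/measurable_EFinP.
Qed.

Lemma integral_cst_le (a : R) : (\int[P]_w a%:E <= a%:E)%E.
Proof. by rewrite integral_cst//= probability_setT mule1. Qed.

Lemma integral_avg_le n (A : 'I_n -> Omega -> R) (C : R) : (0 < n)%N ->
  (forall i w, 0 <= A i w) -> (forall i, measurable_fun setT (A i)) ->
  (forall i, \int[P]_w (A i w)%:E <= C%:E)%E ->
  (\int[P]_w (n%:R^-1 * \sum_(i < n) A i w)%:E <= C%:E)%E.
Proof.
move=> n0 A0 mA AC.
have mAE i : measurable_fun setT (EFin \o A i) by exact/measurable_EFinP.
under eq_integral do rewrite EFinM -sumEFin.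
rewrite ge0_integralZl//; first last.
- by move=> w _; rewrite sume_ge0// => i _; rewrite lee_fin.
- by apply: emeasurable_sum => i; exact: mAE.
rewrite ge0_integral_sum//; last by move=> i w _; rewrite lee_fin.
apply: (@le_trans _ _ (n%:R^-1%:E * \sum_(i < n) C%:E)%E).
  by apply: lee_wpmul2l; [rewrite lee_fin invr_ge0|exact: lee_sum].
by rewrite sumEFin -EFinM sumr_const card_ord -[C *+ n]mulr_natl mulrA mulVf ?mul1r// pnatr_eq0 -lt0n.
Qed.

End NonnegativeIntegrals.
Unset Implicit Arguments.

Theorem theorem2
  (R : realType) (d N K B : nat)
  (d1 : measure_display) (Omega : measurableType d1) (P : probability Omega R)
  (d0 : measure_display) (X : measurableType d0) (D : 'I_N -> probability X R)
  (F : 'I_N -> 'rV[R]_d -> X -> R) (gF : 'I_N -> 'rV[R]_d -> X -> 'rV[R]_d)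
  (f : 'I_N -> 'rV[R]_d -> R) (gf : 'I_N -> 'rV[R]_d -> 'rV[R]_d)
  (h : 'rV[R]_d -> \bar R)
  (xi : nat -> 'I_N -> nat -> 'I_B -> Omega -> X)
  (L rho Bh sigma mu alpha beta : R)
  (z0 : 'rV[R]_d) (c0 : 'I_N -> 'rV[R]_d) (T : nat) :
  (0 < d)%N -> (0 < N)%N -> (0 < K)%N -> (0 < B)%N ->
  (* f_i(x) = E_{xi ~ D_i} F_i(x; xi) *)
  (forall i x, (D i).-integrable setT (fun s => (F i x s)%:E) /\
               ((f i x)%:E = \int[D i]_s (F i x s)%:E)%E) ->
  (* gF i x s = grad F_i(x; s),  gf i x = grad f_i(x) *)
  (forall i s x, has_gradient (fun y => F i y s) x (gF i x s)) ->
  (forall i x, has_gradient (f i) x (gf i x)) ->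
  (* (A1) *)
  (-oo < phistar (phi f h))%E ->
  (* (A2) *)
  0 < L ->
  (forall i x y, f i x - f i y - dotv (gf i y) (x - y) <= L / 2 * normsq (x - y)) ->
  (forall i x y, enorm (gf i x - gf i y) <= L * enorm (x - y)) ->
  (* (A3) *)
  proper_fun h -> lsc h -> 0 <= rho -> weakly_convex rho h ->
  (forall z v, subgrad h z v -> normsq v <= Bh) ->
  (* (A4): fresh samples, i.i.d. with law D_i, independent of everything else *)
  (forall t i k b, measurable_fun setT (xi t i k b)) ->
  (forall t i k b A, measurable A -> P (xi t i k b @^-1` A) = D i A) ->
  mutually_independent P
    (fun p : nat * 'I_N * nat * 'I_B => xi p.1.1.1 p.1.1.2 p.1.2 p.2) ->
  (forall i (Y : Omega -> 'rV[R]_d) (S : Omega -> X),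
      vmeasurable Y -> measurable_fun setT S ->
      vmeasurable (fun w => gF i (Y w) (S w))) ->
  (forall t i k x (j : 'I_d),
      P.-integrable setT (fun w => (gbatch gF i x (fun b => xi t i k b w) 0 j)%:E) /\
      (\int[P]_w (gbatch gF i x (fun b => xi t i k b w) 0 j)%:E = (gf i x 0 j)%:E)%E) ->
  (forall t i k x,
      (\int[P]_w (normsq (gbatch gF i x (fun b => xi t i k b w) - gf i x))%:E
       <= (sigma ^+ 2 / B%:R)%:E)%E) ->
  (* (A5) generalized PL condition *)
  0 < mu ->
  (forall z, ((2 * mu)%:E * (phi f h z - phistar (phi f h))
              <= (normsq (Gmap alpha h gf z))%:E)%E) ->
  (* algorithm parameters *)
  (1 <= T)%N -> 0 < alpha -> 0 < beta ->
  \sum_(i < N) c0 i = 0 ->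
  0 < alpha * (rho + L) + 4 * alpha ^+ 2 * L ^+ 2 ->
  alpha * (rho + L) + 4 * alpha ^+ 2 * L ^+ 2 <= 1 / 2 ->
  alpha * (rho + L) + 4 * alpha ^+ 2 * L ^+ 2
    <= (4 * mu * (rho + L) + 64 * L ^+ 2) / mu ^+ 2 ->
  12 * (6 + ((1 - alpha * rho) ^+ 2)^-1) * beta ^+ 2 * K%:R ^+ 2 * L ^+ 2 <= 1 / 16 ->
  12 * (6 + ((1 - alpha * rho) ^+ 2)^-1) * beta ^+ 2 * K%:R ^+ 2 * L ^+ 2
    <= 1 - alpha * mu / 4 ->
  (\int[P]_w (phi f h (zit K alpha beta h gF xi z0 c0 T w) - phistar (phi f h))
   + alpha%:E * calE P gf (zit K alpha beta h gF xi z0 c0 T)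
                          (cit K alpha beta h gF xi z0 c0 T)
   <= ((1 - alpha * mu / 4) ^+ T)%:E
        * (phi f h z0 - phistar (phi f h)
           + alpha%:E * calE P gf (fun _ => z0) (fun _ => c0))
      + (25 * sigma ^+ 2 / (mu * B%:R * K%:R) + sigma ^+ 2 / (16 * mu * B%:R)
         + Bh / (2 * mu))%:E)%E.
Proof.
move=> d0_gt0 N0 K0 B0 hF gFP gfP phi_lb L0 f_smooth gf_lip h_proper h_lsc rho0 h_wc subB.
move=> mxi _ xi_indep _ unbiased variance mu0 PLe _ alpha0 beta0 c00 _ step _ kap16 kapr.

(* Reduction to real-valued functions and squared norms *)
have gfL i x y : normsq (gf i x - gf i y) <= L ^+ 2 * normsq (x - y).
  by apply: enorm_le; [exact: ltW|exact: gf_lip].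
have [[zf zf_fin] hNy] := h_proper.
have [ps psE] : exists ps, phistar (phi f h) = ps%:E.
  have : (phistar (phi f h) <= phi f h zf)%E by apply: ereal_inf_lbound; exists zf.
  have : (phi f h zf < +oo)%E by rewrite /phi lte_add_pinfty ?ltry.
  case: (phistar _) phi_lb => [r _ _ _|//|//]; first by exists r.
  by move=> _; case: (phi f h zf).
(* (A5) bounds phi(z) - phi^* by a real number, so h is finite everywhere. *)
have hE z : h z = (fine (h z))%:E.
  rewrite fineK// fin_numE gt_eqF ?hNy//=; apply/negP => /eqP hy.
  have := PLe z; rewrite /phi hy psE (_ : (_ + +oo - _ = +oo)%E)//.
  by rewrite gt0_muley ?lte_fin ?mulr_gt0.
pose hr z := fine (h z); rewrite -/(hr _) in hE.
have phiE z : (phi f h z - phistar (phi f h))%E = (favg f z + hr z - ps)%:E.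
  by rewrite psE /phi hE.
have Phi0 z : 0 <= favg f z + hr z - ps.
  rewrite -lee_fin -phiE psE sube_ge0// -psE.
  by apply: ereal_inf_lbound; exists z.
have PL z : 2 * mu * (favg f z + hr z - ps) <= normsq (Gmap alpha h gf z).
  by have := PLe z; rewrite phiE -EFinM lee_fin.
have aL : 2 * L <= alpha^-1.
  rewrite -(ler_pM2l alpha0) mulfV ?gt_eqF//.
  have : 0 <= alpha * rho by rewrite mulr_ge0// ltW.
  have : 0 <= alpha ^+ 2 * L ^+ 2 by rewrite mulr_ge0 ?sqr_ge0.
  by move: step; rewrite mulrDr -(mulrA 4); lra.
(* phi is bounded below and f is bounded above by a quadratic with constant L <= 1 / (2 alpha). *)
have obj_lb y : exists m, forall x, m <= hr x + normsq (x - y) / (2 * alpha).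
  exists (ps - favg f y - normsq (gavg gf y) / (2 * L)) => x.
  have := favg_smooth N0 f_smooth x y; have := Phi0 x.
  have := young_dotv (x - y) (gavg gf y) L0; rewrite dotvC.
  have : 2 * L * normsq (x - y) <= alpha^-1 * normsq (x - y).
    by rewrite ler_wpM2r ?normsq_ge0.
  by rewrite (invfM 2 alpha); set ai := alpha^-1; lra.
have ar1 : alpha * rho < 1 by have := step_rho alpha0 L0 step; lra.
have proxL y y' : normsq (prox alpha h y - prox alpha h y')
    <= ((1 - alpha * rho)^-1) ^+ 2 * normsq (y - y').
  rewrite exprVn ler_pdivlMl ?exprn_gt0 ?subr_gt0//.
  exact: (prox_lipschitz hE h_lsc h_wc alpha0 ar1 obj_lb).
have gFP' i s x : has_gradient (fun y => F i y s) x (gF i x s) by exact: gFP.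
have mF i x : measurable_fun setT (F i x).
  by have [/measurable_int/measurable_EFinP] := hF i x.
pose s2 := sigma ^+ 2 / B%:R.
have s20 : 0 <= s2 by rewrite /s2 divr_ge0 ?sqr_ge0.
pose kap := beta ^+ 2 * K%:R ^+ 2 * L ^+ 2.
have kap0 : 0 <= kap by rewrite /kap mulr_ge0 ?sqr_ge0// mulr_ge0 ?sqr_ge0.
(* Discarding the nonnegative delta leaves 72 = 12 * 6; the bound 1/16 then gives
   [kap <= 1/1152]. *)
have kap72 : 72 * kap <= 12 * (6 + ((1 - alpha * rho) ^+ 2)^-1) * beta ^+ 2 * K%:R ^+ 2 * L ^+ 2.
  set dl := ((1 - alpha * rho) ^+ 2)^-1.
  have : 0 <= dl * kap by rewrite mulr_ge0 ?invr_ge0 ?sqr_ge0.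
  rewrite (_ : 12 * (6 + dl) * _ * _ * _ = 12 * (6 + dl) * kap); last by rewrite /kap; ring.
  by lra.
have kap_small : kap <= 1 / 1152 by lra.
have kap_rate : 24 * kap <= 1 - alpha * mu / 4 by lra.
have r0 : 0 <= 1 - alpha * mu / 4 by lra.
set r := 1 - alpha * mu / 4 in r0 kap_rate *.

(* The potential and its pathwise recursion *)
pose z_ t w := zit K alpha beta h gF xi z0 c0 t w.
pose c_ t w i := cit K alpha beta h gF xi z0 c0 t w i.
pose e_ t i k w := noise (K:=K) gF h alpha beta xi gf z0 c0 t i k w.
pose a2 z (c : 'I_N -> 'rV[R]_d) := N%:R^-1 * \sum_(i < N) normsq (gf i z + c i - gavg gf z).
pose Psi t w := favg f (z_ t w) + hr (z_ t w) - ps + alpha * a2 (z_ t w) (c_ t w).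
have a20 z c : 0 <= a2 z c.
  by rewrite /a2 mulr_ge0 ?invr_ge0// sumr_ge0// => i _; exact: normsq_ge0.
have Psi0 t w : 0 <= Psi t w by rewrite addr_ge0// mulr_ge0 ?(ltW alpha0).
have Bh0 : 0 <= Bh.
  have := subB _ _ (subgrad_prox hE h_lsc h_wc alpha0 ar1 obj_lb 0).
  by apply: le_trans; exact: normsq_ge0.
(* The zero sum persists because [Deltabar] is the mean of the [Delta]s. *)
have c_sum t w : \sum_(i < N) c_ t w i = 0.
  elim: t => [//|t IH]; rewrite /c_ /cit /= -/(zit _ _ _ _ _ _ _ _ t w).
  rewrite sumrB big_split/= -/(cit _ _ _ _ _ _ _ _ t w) IH add0r sumr_const card_ord.
  by rewrite -scaler_nat scalerA mulfV ?scale1r ?subrr// pnatr_eq0 -lt0n.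
pose n_ t i w := avg (fun k : 'I_K => e_ t i k w).
pose Q_ t i w := K%:R^-1 * \sum_(k < K) normsq (e_ t i k w).
have pathwise t w : Psi t.+1 w <= r * Psi t w
    + alpha * (25 / 4 * (N%:R^-1 * \sum_(i < N) normsq (n_ t i w))
               + 1 / 64 * (N%:R^-1 * \sum_(i < N) Q_ t i w) + Bh / 8).
  pose x i k := xt (K:=K) gF h alpha beta xi z0 c0 t i k w.
  have x0 i : x i 0%N = z_ t w by [].
  have xS i k : x i k.+1 = x i k - beta *: (gf i (x i k) + e_ t i k w + c_ t w i).
    have eE : gf i (x i k) + e_ t i k w = gbatch gF i (x i k) (fun b => xi t i k b w).
      by rewrite /e_ /noise addrC subrK.
    by rewrite eE.
  have DE i : Delta K beta gF xi t i (z_ t w) (c_ t w i) w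
      = avg (fun k : 'I_K => gf i (x i k) + e_ t i k w) + c_ t w i.
    by apply: (local_average (xS i)) => //; rewrite gt_eqF.
  have DbE : Deltabar K beta gF xi t (z_ t w) (c_ t w) w
      = avg (fun i => avg (fun k : 'I_K => gf i (x i k) + e_ t i k w)).
    rewrite /Deltabar; under eq_bigr do rewrite DE.
    by rewrite big_split/= c_sum addr0.
  have zS : z_ t.+1 w = prox alpha h (z_ t w - alpha *:
      avg (fun i => avg (fun k : 'I_K => gf i (x i k) + e_ t i k w))).
    by rewrite -DbE.
  pose vv i := avg (fun k : 'I_K => gf i (x i k) + e_ t i k w).
  have cS i : c_ t.+1 w i = avg vv - vv i.
    have -> : c_ t.+1 w i = c_ t w i + Deltabar K beta gF xi t (z_ t w) (c_ t w) w
        - Delta K beta gF xi t i (z_ t w) (c_ t w i) w by [].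
    by rewrite DbE DE -/vv -/(vv i); move: (avg vv) (vv i) (c_ t w i) => *; vring.
  have -> : Psi t.+1 w = favg f (z_ t.+1 w) + hr (z_ t.+1 w) - ps
      + alpha * (N%:R^-1 * \sum_(i < N)
          normsq (gf i (z_ t.+1 w) + (avg vv - vv i) - gavg gf (z_ t.+1 w))).
    by congr (_ + alpha * (_ * _)); apply: eq_bigr => i _; rewrite cS.
  exact: (round_decrease hE h_lsc h_wc alpha0 L0 N0 obj_lb f_smooth gfL subB step
    K0 PL kap_small kap_rate x0 xS zS).

(* Measurability of the iterates and the potential *)
have mzc t : vmeasurable (z_ t) /\ forall i, vmeasurable (fun w => c_ t w i).
  exact: (@vmeasurable_fstate _ _ _ _ _ _ _ F gF h alpha beta _ gFP' mF proxL).
have me t i k : vmeasurable (e_ t i k).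
  exact: (noise_measurable beta gFP' mF proxL z0 c0 gfL mxi t i k).
have mPhi t : measurable_fun setT (fun w => favg f (z_ t w) + hr (z_ t w) - ps).
  have [mz _] := mzc t.
  apply: measurable_funB; last exact: measurable_cst.
  apply: measurable_funD.
    apply: measurable_funM; first exact: measurable_cst.
    apply: measurable_sum => i; apply: measurable_fun_continuous => // x.
    by apply: differentiable_continuous; exact: (gfP i x).1.
  apply/measurable_EFinP; have := measurable_fun_lsc h_lsc mz.
  by congr measurable_fun; apply/funext => w /=; rewrite hE.
have ma t i : measurable_fun setT
    (fun w => normsq (gf i (z_ t w) + c_ t w i - gavg gf (z_ t w))).
  have [mz mc] := mzc t; have mg j : vmeasurable (fun w => gf j (z_ t w)).
    exact: (vmeasurable_lipschitz (gfL j)).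
  apply: measurable_normsq; apply: vmeasurableB; first exact: vmeasurableD.
  by apply: vmeasurableZ; exact: vmeasurable_sum.
have mPsi t : measurable_fun setT (Psi t).
  apply: measurable_funD; first exact: mPhi.
  apply: measurable_funM; first exact: measurable_cst.
  apply: measurable_funM; first exact: measurable_cst.
  by apply: measurable_sum => i; exact: ma.
have mn t i : measurable_fun setT (fun w => normsq (n_ t i w)).
  by apply: measurable_normsq; apply: vmeasurableZ; apply: vmeasurable_sum.
have mQ t i : measurable_fun setT (Q_ t i).
  apply: measurable_funM; first exact: measurable_cst.
  by apply: measurable_sum => k; exact: measurable_normsq.
have Q0 t i w : 0 <= Q_ t i w.
  by rewrite /Q_ mulr_ge0 ?invr_ge0// sumr_ge0// => k _; exact: normsq_ge0.
(* The mean of [K] noises has second moment at most [K^-2 * (K * s2)]. *)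
have nint t i : (\int[P]_w (normsq (n_ t i w))%:E <= (s2 / K%:R)%:E)%E.
  have := noise_sum (K:=K) beta gFP' mF proxL z0 c0 gfL mxi xi_indep unbiased variance t i K.
  have mS : measurable_fun setT (fun w => normsq (\sum_(k < K) e_ t i k w)).
    by apply: measurable_normsq; exact: vmeasurable_sum.
  have KK0 : 0 <= K%:R^-1 ^+ 2 :> R by exact: sqr_ge0.
  move=> /(integral_scale_le KK0 (fun w => normsq_ge0 _) mS).
  rewrite (_ : K%:R^-1 ^+ 2 * (K%:R * (sigma ^+ 2 / B%:R)) = s2 / K%:R); last first.
    by rewrite /s2; field; rewrite !pnatr_eq0 -!lt0n K0 B0.
  apply: le_trans; rewrite le_eqVlt; apply/orP; left; apply/eqP.
  by apply: eq_integral => w _; rewrite -normsqZ.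
have Qint t i : (\int[P]_w (Q_ t i w)%:E <= s2%:E)%E.
  apply: integral_avg_le => // [k w|k|k]; first exact: normsq_ge0.
    exact: measurable_normsq.
  exact: (noise_second_moment beta gFP' mF proxL z0 c0 gfL mxi xi_indep unbiased variance t i k).

(* Recursion in expectation *)
pose m := alpha * (25 / 4 * (s2 / K%:R) + 1 / 64 * s2 + Bh / 8).
(* M is the fixed point of C |-> r C + m. *)
pose M := 25 * sigma ^+ 2 / (mu * B%:R * K%:R) + sigma ^+ 2 / (16 * mu * B%:R)
         + Bh / (2 * mu).
(* As [1 - r = alpha * mu / 4], M equals [4 * m / (alpha * mu)]: the constants 25/4, 1/64, 1/8
   become 25, 1/16, 1/2 over [mu]. *)
have rM : r * M + m = M.
  by rewrite /r /M /m /s2; field; rewrite !pnatr_eq0 -!lt0n K0 B0 gt_eqF.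
have M0 : 0 <= M.
  rewrite (_ : M = (25 * (s2 / K%:R) + s2 / 16 + Bh / 2) / mu); last first.
    by rewrite /M /s2; field; rewrite !pnatr_eq0 -!lt0n K0 B0 gt_eqF.
  apply: divr_ge0; last exact: ltW.
  apply: addr_ge0; last by apply: divr_ge0.
  apply: addr_ge0; last by apply: divr_ge0.
  by apply: mulr_ge0 => //; apply: divr_ge0.
have rec t C : (\int[P]_w (Psi t w)%:E <= C%:E)%E ->
    (\int[P]_w (Psi t.+1 w)%:E <= (r * C + m)%:E)%E.
  move=> IH.
  pose NN w := N%:R^-1 * \sum_(i < N) normsq (n_ t i w).
  pose QQ w := N%:R^-1 * \sum_(i < N) Q_ t i w.
  have NN0 w : 0 <= NN w by rewrite mulr_ge0 ?invr_ge0// sumr_ge0// => i _; exact: normsq_ge0.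
  have QQ0 w : 0 <= QQ w by rewrite mulr_ge0 ?invr_ge0// sumr_ge0.
  have mNN : measurable_fun setT NN.
    by apply: measurable_funM; [exact: measurable_cst|exact: measurable_sum].
  have mQQ : measurable_fun setT QQ.
    by apply: measurable_funM; [exact: measurable_cst|exact: measurable_sum].
  have iNN : (\int[P]_w (NN w)%:E <= (s2 / K%:R)%:E)%E.
    by apply: integral_avg_le => // i w; exact: normsq_ge0.
  have iQQ : (\int[P]_w (QQ w)%:E <= s2%:E)%E by exact: integral_avg_le.
  pose U1 w := 25 / 4 * NN w + 1 / 64 * QQ w.
  have U10 w : 0 <= U1 w by rewrite /U1 addr_ge0// mulr_ge0.
  have mU1 : measurable_fun setT U1.
    by apply: measurable_funD; apply: measurable_funM => //; exact: measurable_cst.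
  have iU1 : (\int[P]_w (U1 w)%:E <= (25 / 4 * (s2 / K%:R) + 1 / 64 * s2)%:E)%E.
    by apply: integral_lin_le.
  pose U w := 1 * U1 w + 1 * (Bh / 8).
  have B80 : 0 <= Bh / 8 by rewrite divr_ge0.
  have iU : (\int[P]_w (U w)%:E <= (1 * (25 / 4 * (s2 / K%:R) + 1 / 64 * s2) + 1 * (Bh / 8))%:E)%E.
    apply: (@integral_lin_le _ _ _ _ U1 (fun=> Bh / 8)) => //; exact: integral_cst_le.
  have mU : measurable_fun setT U.
    apply: measurable_funD; last exact: measurable_cst.
    by apply: measurable_funM => //; exact: measurable_cst.
  have U0 w : 0 <= U w by rewrite /U !mul1r addr_ge0.
  have H := integral_lin_le r0 (ltW alpha0) (Psi0 t) U0 (mPsi t) mU IH iU.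
  rewrite (_ : r * C + alpha * _ = r * C + m) in H; last by rewrite /m; ring.
  apply: (le_trans _ H).
  apply: ge0_le_integral => //.
  - by move=> w _; rewrite lee_fin.
  - exact/measurable_EFinP/mPsi.
  - apply/measurable_EFinP; apply: measurable_funD; apply: measurable_funM => //; exact: measurable_cst.
  - move=> w _; rewrite lee_fin.
    rewrite (_ : U w = 25 / 4 * NN w + 1 / 64 * QQ w + Bh / 8); first exact: pathwise.
    by rewrite /U /U1; ring.
pose C0 := favg f z0 + hr z0 - ps + alpha * a2 z0 c0.
have main t : (\int[P]_w (Psi t w)%:E <= (r ^+ t * C0 + M)%:E)%E.
  elim: t => [|t /rec IH].
    by apply: (le_trans (integral_cst_le P C0)); rewrite lee_fin expr0 mul1r lerDl.
  by apply: (le_trans IH); rewrite lee_fin mulrDr -addrA rM exprS mulrA.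

(* From the potential to the two separate expectations *)
have calE_E z c : (forall i, measurable_fun setT (fun w => normsq (gf i (z w) + c w i - gavg gf (z w)))) ->
    (alpha%:E * calE P gf z c = \int[P]_w (alpha * a2 (z w) (c w))%:E)%E.
  move=> mzc'.
  have mE i : measurable_fun setT (fun w => (normsq (gf i (z w) + c w i - gavg gf (z w)))%:E).
    exact/measurable_EFinP.
  rewrite /calE -ge0_integral_sum//; last by move=> i w _; rewrite lee_fin normsq_ge0.
  have iN0 : 0 <= N%:R^-1 :> R by rewrite invr_ge0.
  rewrite -ge0_integralZl//; last 2 first.
  - by apply: emeasurable_sum.
  - by move=> w _; apply: sume_ge0 => i _; rewrite lee_fin normsq_ge0.
  rewrite -ge0_integralZl//; last 3 first.
  - by apply: emeasurable_funM; [exact: measurable_cst|exact: emeasurable_sum].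
  - move=> w _; rewrite mule_ge0 ?lee_fin//.
    by apply: sume_ge0 => i _; rewrite lee_fin normsq_ge0.
  - by rewrite lee_fin ltW.
  by apply: eq_integral => w _; rewrite sumEFin -!EFinM.
rewrite calE_E; last by move=> i; exact: (ma T i).
under eq_integral do rewrite phiE.
rewrite -ge0_integralD//; first last.
- apply/measurable_EFinP; apply: measurable_funM; first exact: measurable_cst.
  apply: measurable_funM; first exact: measurable_cst.
  by apply: measurable_sum => i; exact: ma.
- by move=> w _; rewrite lee_fin mulr_ge0// ltW.
- by apply/measurable_EFinP; exact: mPhi.
- by move=> w _; rewrite lee_fin; exact: Phi0.
rewrite phiE calE_E; last by move=> i; exact: measurable_cst.
rewrite integral_cst//= probability_setT mule1.
exact: main.
Qed.
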